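(* Let $d \ge 3$ be a prime. Define polynomials $r_n, s_n \in \mathbb{Z}[b]$ by $r_0 = s_0 = 1$ and, for $n \ge 0$, \[ r_{n+1} = (b+1)\,d\, r_n s_n^{d-1}, \qquad s_{n+1} = r_n^d + (d-1) s_n^d. \] For $m \ge 1$ let \[ \mathcal{G}_m(b) = \frac{1}{bd}\left[(b+1)^d d^d s_{m-1}^{d(d-1)} - (bd+1)\,\frac{s_m^d - \bigl((b+1)d\, s_{m-1}^d\bigr)^d}{s_m - (b+1)d\, s_{m-1}^d}\right] \in \mathbb{Z}[b], \] and let $G_m(a) \in \mathbb{Q}[a]$ be the polynomial determined by $G_m((b+1)d) = \mathcal{G}_m(b)$, i.e. $G_m(a) = \mathcal{G}_m(a/d - 1)$. Then for every $m \ge 1$ there exists an irreducible factor $F_m$ of $G_m$ over $\mathbb{Q}$ such that \[ \liminf_{m \to \infty} \frac{\deg F_m}{\deg G_m} \ge 1 - \frac{1}{d^d}. \] Moreover, if $1 \le m \le d$, then $G_m$ is irreducible over $\mathbb{Q}$.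
   Context: The polynomial $G_m$ is the Misiurewicz polynomial for the dynamical portrait $(m,1)$ associated to the one-parameter family of degree-$d$ rational maps $\phi_a(z) = \frac{az}{z^d + d - 1}$ ($a \ne 0$); after the change of variable $a = (b+1)d$, the map in homogeneous coordinates is $\varphi_b([x,y]) = [(b+1)d\,x y^{d-1},\, x^d + (d-1)y^d]$, and $\varphi_b^n([1,1]) = [r_n, s_n]$. The expression defining $\mathcal{G}_m$ is a polynomial in $b$ with integer coefficients. *)

(* Defs.v *)
From HB Require Import structures.
From mathcomp Require Import all_boot all_order all_algebra.
From mathcomp Require Import ring.

Set Implicit Arguments.
Unset Strict Implicit.
Unset Printing Implicit Defensive.

Import Order.TTheory GRing.Theory Num.Theory.
Local Open Scope ring_scope.

(* The pair (r_n, s_n) in Z[b]^2; the indeterminate b is 'X. *)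
Fixpoint rs (d n : nat) : {poly int} * {poly int} :=
  if n is n'.+1 then
    let: (r, s) := rs d n' in
    (('X + 1) * d%:R * r * s ^+ (d - 1), r ^+ d + (d - 1)%:R * s ^+ d)
  else (1, 1).

Definition rpoly (d n : nat) : {poly int} := (rs d n).1.
Definition spoly (d n : nat) : {poly int} := (rs d n).2.

(* Both quotients are taken with %/ in Q[b], where they are exact for m >= 1
   (see calG_spec); %/ on {poly int} would only be a pseudo-division.
   The value at m = 0 is meaningless. *)
Definition calG (d m : nat) : {poly rat} :=
  let s : {poly rat} := map_poly intr (spoly d m) in
  let s' : {poly rat} := map_poly intr (spoly d (m - 1)) in
  let t : {poly rat} := ('X + 1) * d%:R * s' ^+ d in
  (('X + 1) ^+ d * d%:R ^+ d * s' ^+ (d * (d - 1))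
     - ('X * d%:R + 1) * ((s ^+ d - t ^+ d) %/ (s - t)))
  %/ ('X * d%:R).

Definition Gpoly (d m : nat) : {poly rat} :=
  calG d m \Po ((d%:R)^-1 *: 'X - 1).

Definition pdeg (R : nzSemiRingType) (p : {poly R}) : nat := (size p).-1.

Lemma rpolyS d n :
  rpoly d n.+1 = ('X + 1) * d%:R * rpoly d n * spoly d n ^+ (d - 1).
Proof. by rewrite /rpoly /spoly /=; case: (rs d n). Qed.

Lemma spolyS d n :
  spoly d n.+1 = rpoly d n ^+ d + (d - 1)%:R * spoly d n ^+ d.
Proof. by rewrite /rpoly /spoly /=; case: (rs d n). Qed.

Lemma rpoly_dvd d n : exists u, rpoly d n.+1 = d%:R * u.
Proof.
exists (('X + 1) * rpoly d n * spoly d n ^+ (d - 1)); rewrite rpolyS; ring.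
Qed.

Lemma spoly_dvd d n : (0 < d)%N -> exists u, spoly d n.+1 = d%:R * u.
Proof.
case: d => // d _; elim: n => [|n [v hv]].
  exists 1; rewrite spolyS /rpoly /spoly /= !expr1n !mulr1 subn1 /=.
  by rewrite -[1]/(1%:R) -natrD add1n.
have [u hu] := rpoly_dvd d.+1 n.
exists (u * rpoly d.+1 n.+1 ^+ d
        + v * (d.+1 - 1)%:R * spoly d.+1 n.+1 ^+ d).
move: (spolyS d.+1 n.+1) hu hv.
move: (rpoly _ n.+1) (spoly _ n.+1) (d.+1 - 1)%:R d.+1%:R => r s e k.
rewrite !exprS => -> hu hv; rewrite {1}hu {1}hv; ring.
Qed.

Lemma rs_at0 d n : (0 < d)%N -> (rpoly d n).[0] = (spoly d n).[0].
Proof.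
case: d => // d _; elim: n => [|n IH]; first by rewrite /rpoly /spoly.
rewrite rpolyS spolyS subn1 /= -!polyC_natr !hornerE ?horner_exp -!IH exprS.
rewrite -natr1; ring.
Qed.

Lemma rpoly_atN1 d n : (rpoly d n.+1).[-1] = 0.
Proof. by rewrite rpolyS !hornerM hornerD hornerX hornerC addNr !mul0r. Qed.

Lemma spoly_atN1 d n : (1 < d)%N -> (spoly d n.+1).[-1] != 0.
Proof.
move=> d_gt1; have d1_gt0 : (0 < d - 1)%N by rewrite subn_gt0.
elim: n => [|n IH].
  rewrite spolyS /rpoly /spoly /= !expr1n mulr1 -polyC_natr hornerD !hornerC.
  by rewrite -[1]/(1%:R) -natrD pnatr_eq0.
rewrite spolyS -polyC_natr hornerD hornerM hornerC !horner_exp rpoly_atN1.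
rewrite expr0n gtn_eqF ?(ltnW d_gt1) // add0r.
by rewrite mulf_neq0 ?expf_neq0 // pnatr_eq0 -lt0n.
Qed.

Lemma calG_spec (d m : nat) : (1 < d)%N -> (0 < m)%N ->
  let s := spoly d m in
  let s' := spoly d (m - 1) in
  let t := ('X + 1) * d%:R * s' ^+ d in
  s - t != 0 /\
  exists2 P : {poly int}, calG d m = map_poly intr P &
    ('X * d%:R * P) * (s - t) =
      (('X + 1) ^+ d * d%:R ^+ d * s' ^+ (d * (d - 1))) * (s - t)
        - ('X * d%:R + 1) * (s ^+ d - t ^+ d).
Proof.
case: m => // m d_gt1 _; rewrite subn1 /=.
have d_gt0 := ltnW d_gt1.
set s := spoly d m.+1; set s' := spoly d m; set t := _ * s' ^+ d.
have nz : s - t != 0.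
  apply: contraNneq (spoly_atN1 m d_gt1) => /(congr1 (horner^~ (-1))).
  rewrite hornerD hornerN horner0 /t !hornerM hornerD hornerX hornerC addNr.
  by rewrite !mul0r subr0 => ->.
split=> //.
pose Q := \sum_(i < d) s ^+ (d.-1 - i) * t ^+ i.
pose B := ('X + 1) ^+ d * d%:R ^+ d * s' ^+ (d * (d - 1)) - ('X * d%:R + 1) * Q.
have s0 : s.[0] = t.[0].
  rewrite /s /t spolyS -/s' -!polyC_natr !hornerE ?horner_exp rs_at0 //.
  by rewrite natrB // -/s'; ring.
have B0 : B.[0] = 0.
  rewrite /B /Q -!polyC_natr !hornerE horner_sum.
  under eq_bigr => i _.
    have -> : (s ^+ (d.-1 - i) * t ^+ i).[0] = t.[0] ^+ d.-1.
      rewrite hornerM ?horner_exp s0 -exprD subnK //.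
      by rewrite -ltnS prednK.
    over.
  rewrite sumr_const card_ord ?horner_exp /t -polyC_natr !hornerE ?horner_exp.
  case: d d_gt0 {s t nz Q B s0 d_gt1} @s' => // d _ s' /=.
  rewrite expr1n subn1 /= exprMn -exprM -mulr_natl exprS; ring.
have [C hC] : exists C, B = d%:R * C.
  have [u hu] := spoly_dvd m d_gt0.
  pose v := ('X + 1) * s' ^+ d.
  have hs : s = d%:R * u by [].
  have ht : t = d%:R * v by rewrite /t /v; ring.
  have [q hq] : exists q, Q = d%:R * q.
    exists (d%:R ^+ d.-2 * \sum_(i < d) u ^+ (d.-1 - i) * v ^+ i).
    have d1 : d.-2.+1 = d.-1 by case: (d) d_gt1 => [|[]].
    rewrite mulrA -exprS d1 /Q mulr_sumr.
    apply: eq_bigr => i _; rewrite hs ht !exprMn mulrACA -exprD subnK //.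
    by rewrite -ltnS prednK.
  exists (('X + 1) ^+ d * d%:R ^+ d.-1 * s' ^+ (d * (d - 1))
          - ('X * d%:R + 1) * q).
  rewrite /B hq -{3}(prednK d_gt0) exprS; ring.
have dP : (d%:R : {poly int}) != 0 by rewrite -polyC_natr polyC_eq0 pnatr_eq0 -lt0n.
have C0 : root C 0.
  apply/rootP; move: B0; rewrite hC -polyC_natr !hornerE => /eqP.
  by rewrite mulf_eq0 pnatr_eq0 -[d == 0]negbK -lt0n d_gt0 => /eqP.
have [P hP] := factor_theorem _ _ C0.
have BP : B = 'X * d%:R * P by rewrite hC hP subr0; ring.
exists P; last by rewrite -BP /B subrXX -/Q; ring.
have dQ : (d%:R : {poly rat}) != 0 by rewrite -polyC_natr polyC_eq0 pnatr_eq0 -lt0n.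
pose f : {rmorphism {poly int} -> {poly rat}} := map_poly intr.
have fE p : map_poly intr p = f p by [].
have fX : f 'X = 'X by apply: map_polyX.
have ft : f t = ('X + 1) * d%:R * f s' ^+ d.
  by rewrite /t !rmorphM rmorphD rmorphXn rmorph1 rmorph_nat fX.
have nzf : f s - f t != 0.
  by rewrite -rmorphB -fE map_poly_eq0_id0 // intr_eq0 lead_coef_eq0.
rewrite /calG subn1 /= -/s -/s' !fE -ft.
have -> : f s ^+ d - f t ^+ d = (f s - f t) * f Q.
  have := congr1 f (subrXX s t d).
  by rewrite -/Q rmorphB !rmorphXn [f (_ * Q)]rmorphM [f (s - t)]rmorphB.
rewrite mulKp //.
have -> : ('X + 1) ^+ d * d%:R ^+ d * f s' ^+ (d * (d - 1))
          - ('X * d%:R + 1) * f Q = f B.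
  rewrite /B rmorphB !rmorphM !rmorphXn !rmorphD !rmorphM !rmorph1.
  by rewrite !rmorph_nat fX.
rewrite BP !rmorphM rmorph_nat fX.
by rewrite mulKp // mulf_neq0 ?polyX_eq0.
Qed.

(* Main.v *)
(* Writing E_m = r_m^d - (bd+1) s_m^d, one has bd G_m = E_m / E_(m-1), and after
   removing powers of d from r_m and s_m the polynomial G_m is congruent to a
   unit times b^N modulo d, where N = d^m - d^(m-1) - 1.  Its d-adic Newton
   polygon on [0, N] is a single segment of height h = d^(m-1): expanding
   s_m = E_(m-1) + (b+1) d s_(m-1)^d binomially bounds the Gauss valuation of
   slope h/N inductively, and the constant coefficient has valuation exactly h.
   Since h and N are coprime, Dumas' argument yields an irreducible factor of
   degree at least N.  The degree of s_m exceeds d^(m-1) only because of the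
   parameter b = oo, which contributes one extra unit of degree every d steps;
   hence deg G_m is asymptotically N d^d / (d^d - 1), and it equals N for
   m <= d, m <> 2.  For m = 2 it is N + 1, and a linear cofactor would give an
   integer a, prime to d, solving a Diophantine equation that is impossible
   for size reasons. *)
Require Import Defs.
From mathcomp Require Import all_boot all_order all_algebra.
From mathcomp Require Import all_classical all_reals all_analysis.
From mathcomp Require Import zify ring lra.

Import Order.TTheory GRing.Theory Num.Theory.
Local Open Scope ring_scope.

(** * Gauss valuations and Dumas irreducibility *)

(* The Gauss valuation extending the p-adic one by v(X) = h / N is at least
   w / N. *)
Definition weight_ge (p N h w : nat) (P : {poly int}) : Prop :=
  forall i, exists2 k, ((p ^ k)%:Z %| P`_i)%Z & (w <= N * k + h * i)%N.

Section Weight.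

Variables (p N h : nat).
Hypothesis N_gt0 : (0 < N)%N.

Local Notation wge := (weight_ge p N h).

Lemma weight_ge_coef_sum (I : Type) (r : seq I) (Q : pred I) (c : I -> int)
    (w e : nat) :
  (forall i, Q i -> exists2 k, ((p ^ k)%:Z %| c i)%Z & (w <= N * k + e)%N) ->
  exists2 k, ((p ^ k)%:Z %| \sum_(i <- r | Q i) c i)%Z & (w <= N * k + e)%N.
Proof.
move=> c_ge; elim/big_ind: _ => [|x y [k kx wk] [l ly wl]|//].
  (* The empty sum is 0, divisible by every power of p; the exponent [w] is large enough because [N]
     is positive. *)
  by exists w; [rewrite dvdz0 | nia].
exists (minn k l); last by rewrite /minn; case: ifP.
apply: rpredD; [apply: dvdz_trans kx | apply: dvdz_trans ly];
  by rewrite dvdzE /= dvdn_exp2l // ?geq_minl ?geq_minr.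
Qed.

Lemma weight_ge_leq w w' P : (w' <= w)%N -> wge w P -> wge w' P.
Proof. by move=> ww' wP i; have [k kP wk] := wP i; exists k => //; lia. Qed.

Lemma weight_ge_sum (I : Type) (r : seq I) (Q : pred I) (F : I -> {poly int}) w :
  (forall i, Q i -> wge w (F i)) -> wge w (\sum_(i <- r | Q i) F i).
Proof.
by move=> F_ge i; rewrite coef_sum; apply: weight_ge_coef_sum => j /F_ge; apply.
Qed.

Lemma weight_geD w P Q : wge w P -> wge w Q -> wge w (P + Q).
Proof.
move=> wP wQ.
have -> : P + Q = \sum_(i <- [:: P; Q]) i by rewrite !big_cons big_nil addr0.
rewrite big_seq; apply: weight_ge_sum => i.
by rewrite !inE => /orP[] /eqP ->.
Qed.

Lemma weight_geN w P : wge w P -> wge w (- P).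
Proof.
by move=> wP i; have [k kP wk] := wP i; exists k => //; rewrite coefN rpredN.
Qed.

(** Exponents add along the convolution, as h j + h (i - j) = h i. The slack [w <= u + v] leaves the
    numerical estimate to the caller as a separate goal. *)
Lemma weight_geM u v w P Q :
  (w <= u + v)%N -> wge u P -> wge v Q -> wge w (P * Q).
Proof.
move=> w_le wP wQ i; rewrite coefM; apply: weight_ge_coef_sum => -[j /= j_le] _.
have [k kP uk] := wP j; have [l lQ vl] := wQ (i - j)%N.
exists (k + l)%N; last by nia.
by rewrite expnD PoszM dvdz_mul.
Qed.

Lemma weight_ge0 P : wge 0 P.
Proof. by move=> i; exists 0%N; rewrite ?dvd1z. Qed.

Lemma weight_geX u w n P : (w <= u * n)%N -> wge u P -> wge w (P ^+ n).
Proof.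
move=> w_le wP; apply: weight_ge_leq w_le _.
elim: n => [|n IHn]; first by rewrite muln0; apply: weight_ge0.
by rewrite exprS mulnS; apply: weight_geM wP IHn.
Qed.

Lemma weight_geXn w n : (w <= h * n)%N -> wge w 'X^n.
Proof.
move=> w_le i; rewrite coefXn; have [->|_] := eqVneq.
  by exists 0%N; rewrite ?dvd1z //; lia.
by exists w; rewrite ?dvdz0 //; nia.
Qed.

Lemma weight_ge_nat w n c : (p ^ c %| n)%N -> (w <= N * c)%N -> wge w n%:R.
Proof.
move=> cn w_le i; rewrite -polyC_natr coefC; have [->|_] := eqVneq.
  by exists c; last lia; rewrite dvdzE natz.
by exists w; rewrite ?dvdz0 //; nia.
Qed.

End Weight.

Section Dumas.

Variables (p N h : nat).
Hypothesis p_prime : prime p.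

Local Notation om A i := (N * logn p `|(A`_i)%R| + h * i)%N.

Lemma min_weight_index (A : {poly int}) : A != 0 ->
  exists2 i, A`_i != 0 &
    forall j, A`_j != 0 -> (om A i <= om A j)%N /\ ((j < i)%N -> (om A i < om A j)%N).
Proof.
move=> A0; have sA : (0 < size A)%N by rewrite lt0n size_poly_eq0.
have s1 : ((size A).-1 < size A)%N by rewrite ltn_predL.
have lA : A`_(Ordinal s1) != 0 by rewrite -lead_coefE lead_coef_eq0.
(* As indices stay below [size A], minimising this number orders the pairs (weight, index)
   lexicographically. *)
pose f (i : 'I_(size A)) := (om A i * size A + i)%N.
case: (@arg_minnP _ (Ordinal s1) (fun i => A`_i != 0) f lA) => i Ai min_i.
exists (i : nat) => // j Aj.
have jA : (j < size A)%N.
  by rewrite ltnNge; apply: contra Aj => /(nth_default 0) ->.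
have key x y s k l : (k < s -> l < s -> x * s + k <= y * s + l ->
    (x <= y) /\ (l < k -> x < y))%N by split; nia.
exact: key (ltn_ord i) jA (min_i (Ordinal jA) Aj).
Qed.

(* The coefficient at the sum of the two least indices of minimal weight has
   exactly one summand of minimal p-adic valuation. *)
Lemma min_weight_mul (A B : {poly int}) w :
  A != 0 -> B != 0 -> weight_ge p N h w (A * B) ->
  exists u v, [/\ (w <= u + v)%N, forall i, A`_i != 0 -> (u <= om A i)%N &
    forall i, B`_i != 0 -> (v <= om B i)%N].
Proof.
move=> A0 B0 wAB; have [i Ai min_i] := min_weight_index _ A0.
have [j Bj min_j] := min_weight_index _ B0.
exists (om A i), (om B j); split=> [|k /min_i[] //|k /min_j[] //].
have [k kAB wk] := wAB (i + j)%N.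
set a := logn p `|A`_i| in min_i *; set b := logn p `|B`_j| in min_j *.
suff k_le : (k <= a + b)%N.
  have : (N * k <= N * (a + b))%N by rewrite leq_mul2l k_le orbT.
  by rewrite mulnDr; lia.
rewrite leqNgt; apply/negP => ab_k.
have : ((p ^ (a + b).+1)%:Z %| (A * B)`_(i + j))%Z.
  by apply: dvdz_trans kAB; rewrite dvdzE /= dvdn_exp2l.
have lt_i : (i < (i + j).+1)%N by rewrite ltnS leq_addr.
(* For l < i the weight at A_l is strictly larger, for l > i the weight at B_(i+j-l) is; the parts
   in h have equal sums, so the valuation of the product exceeds a + b. *)
rewrite coefM (bigD1 (Ordinal lt_i)) //= addKn rpredDr; last first.
  apply: rpred_sum => -[l /= l_le] /eqP li.
  have {}li : l <> i by move=> e; apply: li; apply: val_inj.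
  have [->|Al] := eqVneq A`_l 0; first by rewrite mul0r dvdz0.
  have [->|Bl] := eqVneq B`_(i + j - l) 0; first by rewrite mulr0 dvdz0.
  rewrite dvdzE abszM /= pfactor_dvdn // ?muln_gt0 ?absz_gt0 ?Al //.
  rewrite lognM ?absz_gt0 //.
  have [le1 lt1] := min_i _ Al; have [le2 lt2] := min_j _ Bl.
  have hl : (h * l + h * (i + j - l) = h * i + h * j)%N.
    by rewrite -!mulnDr subnKC.
  suff lt_N : (N * a + N * b < N * logn p `|(A`_l)%R| +
      N * logn p `|(B`_(i + j - l))%R|)%N.
    by rewrite -!mulnDr ltn_mul2l in lt_N; case/andP: lt_N.
  have [l_lt|l_gt] : (l < i \/ i < l)%N by lia.
    by have := lt1 l_lt; lia.
  have jl : (i + j - l < j)%N by lia.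
  by have := lt2 jl; lia.
rewrite dvdzE abszM /= pfactor_dvdn // ?muln_gt0 ?absz_gt0 ?Ai //.
by rewrite lognM ?absz_gt0 // -/a -/b ltnn.
Qed.

Lemma squeeze_add (x y a b c e M : nat) : (M <= x + y -> y <= b -> x <= a ->
  y <= e -> x <= c -> a + b = M -> c + e = M -> c = a)%N.
Proof. lia. Qed.

(** As p does not divide P_N, it divides neither A_j nor B_(N-j) for some j. The least weights
    satisfy u + v >= h N, while the weights of A_j and B_(N-j), and likewise those of A_0 and B_0,
    add up to exactly h N. Hence all are minimal, h j = N v_p(A_0), and coprimality leaves j = 0 or
    j = N. *)
Lemma dumas (P A B : {poly int}) :
  coprime N h -> weight_ge p N h (h * N) P ->
  P`_0 != 0 -> logn p `|P`_0| = h -> ~~ (p %| P`_N)%Z -> P = A * B ->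
  (~~ (p %| A`_0)%Z /\ ~~ (p %| B`_N)%Z) \/
  (~~ (p %| A`_N)%Z /\ ~~ (p %| B`_0)%Z).
Proof.
move=> co_Nh wP P0 vP0 PN PE; subst P.
have nz_coef (C : {poly int}) i : C`_i != 0 -> C != 0.
  by apply: contraNneq => ->; rewrite coef0.
move: P0 vP0; rewrite coef0M mulf_eq0 negb_or => /andP[A0 B0].
rewrite abszM lognM ?absz_gt0 // => v0.
have [u [v [uv_ge u_le v_le]]] :=
  min_weight_mul _ _ _ (nz_coef _ _ A0) (nz_coef _ _ B0) wP.
have [j /andP[Aj Bj]] : exists j : 'I_N.+1, ~~ (p %| A`_j)%Z && ~~ (p %| B`_(N - j))%Z.
  apply/existsP; apply: contraR PN => /existsPn AB; rewrite coefM.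
  apply: rpred_sum => j _; have := AB j; rewrite negb_and !negbK.
  by case/orP=> ?; [apply: dvdz_mulr | apply: dvdz_mull].
have jN : (j <= N)%N by rewrite -ltnS.
have unit_coef c : ~~ (p %| c)%Z -> c != 0 /\ logn p `|c| = 0%N.
  move=> pc; have c0 : c != 0 by apply: contraNneq pc => ->; rewrite dvdz0.
  split=> //; apply/eqP; rewrite -leqn0 leqNgt; apply: contra pc => c1.
  by rewrite dvdzE /= -(expn1 p) pfactor_dvdn ?absz_gt0.
have [Aj0 vAj] := unit_coef _ Aj; have [Bj0 vBj] := unit_coef _ Bj.
have := u_le _ Aj0; have := v_le _ Bj0; have := u_le _ A0; have := v_le _ B0.
rewrite vAj vBj !muln0 !add0n !addn0 => v1 u1 v2 u2.
have Nj : (N %| j * h)%N.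
  apply/dvdnP; exists (logn p `|(A`_0)%R|).
  rewrite [LHS]mulnC [RHS]mulnC.
  by apply: squeeze_add uv_ge v1 u1 v2 u2 _ _;
    rewrite -mulnDr ?v0 ?subnKC // mulnC.
move: Nj; rewrite Gauss_dvdl // => /dvdnP[[|k] jk].
  by left; move: Aj Bj; rewrite jk mul0n subn0.
have {}jk : (j : nat) = N by apply/eqP; rewrite eqn_leq jN jk leq_pmull.
by right; move: Aj Bj; rewrite jk subnn.
Qed.

(** Choosing the irreducible factor by its constant coefficient excludes the first alternative of
    [dumas]. It is found by descent: a rational splitting lifts to the integers by Gauss's lemma,
    and p divides one of the two constant coefficients. *)
Lemma irreducible_factor_dvd_const (P : {poly int}) :
  (1 < size P)%N -> (p %| P`_0)%Z ->
  exists A B : {poly int}, [/\ P = A * B, (p %| A`_0)%Z &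
    irreducible_poly (map_poly (intr : int -> rat) A)].
Proof.
have [n] := ubnP (size P); elim: n P => // n IHn P sP P1 P0.
case: (pselect (irreducible_poly (map_poly (intr : int -> rat) P))).
  by exists P, 1; rewrite mulr1.
move=> redP.
have [q sq [qP qnP]] : exists2 q : {poly rat}, size q != 1%N &
    q %| map_poly intr P /\ ~~ (q %= map_poly intr P).
  apply: contrapT => noq; apply: redP; split; first by rewrite size_rat_int_poly.
  move=> q sq qP; apply/negPn/negP => qnP; apply: noq; exists q => //.
have Pn0 : P != 0 by rewrite -size_poly_gt0; lia.
have [Q [a a0 qE] [C PE]] := dvdpP_rat_int qP.
have sqQ : size q = size Q by rewrite qE size_scale // size_rat_int_poly.
have [Q0 C0] : Q != 0 /\ C != 0 by apply/andP; rewrite -negb_or -mulf_eq0 -PE.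
have sPE : size P = (size Q + size C).-1 by rewrite PE size_mul.
have sQP : size Q != size P.
  by rewrite -sqQ -(size_rat_int_poly P) dvdp_size_eqp.
move: Q0 C0; rewrite -!size_poly_gt0 => Q0 C0; rewrite sqQ in sq.
have : (p %| Q`_0 * C`_0)%Z by rewrite -coef0M -PE.
rewrite dvdzE abszM Euclid_dvdM // => /orP[pQ|pC].
- have [||| A [B [QE A0 irrA]]] := IHn Q; [lia|lia|by []|].
  by exists A, (B * C); rewrite mulrA -QE.
- have [||| A [B [CE A0 irrA]]] := IHn C; [lia|lia|by []|].
  by exists A, (B * Q); rewrite mulrA -CE mulrC.
Qed.

End Dumas.

(** * The reduced recursion *)

(* Index n stands for n + 1 in the original recursion; see [rs_red]. *)
Fixpoint red_rs (d n : nat) : {poly int} * {poly int} :=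
  if n is n'.+1 then
    let: (r, s) := red_rs d n' in
    (('X + 1) * d%:R * r * s ^+ (d - 1), r ^+ d + (d - 1)%:R * s ^+ d)
  else ('X + 1, 1).

Definition red_r (d n : nat) : {poly int} := (red_rs d n).1.
Definition red_s (d n : nat) : {poly int} := (red_rs d n).2.

(** For z = r / s, the equation z^d = b d + 1 characterises the nonzero fixed points of the map. Up
    to a power of d this is E_(n+1), see [Epoly_red_E]. *)
Definition red_E (d n : nat) : {poly int} :=
  red_r d n ^+ d - ('X * d%:R + 1) * red_s d n ^+ d.

Definition red_t (d : nat) (s : {poly int}) : {poly int} :=
  ('X + 1) * d%:R * s ^+ d.

(* The quotient red_E (n+1) / (X red_E n), read off from the binomial expansion
   of red_s (n+1)^d = (X^2 q + red_t d s)^d. *)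
Definition red_G_next (d : nat) (s q : {poly int}) : {poly int} :=
  - ((d - 1)%:R * d%:R * red_t d s ^+ (d - 1))
  - ('X * d%:R + 1) * \sum_(i < d - 1)
      'C(d, i.+2)%:R * red_t d s ^+ (d - 2 - i) * ('X^(i.*2.+1) * q ^+ i.+1).

(** The cofactor of X^2 in [red_E], see [red_E_sq]; the base case is ((1 + X)^d - 1 - d X) / X^2. *)
Fixpoint red_q (d n : nat) : {poly int} :=
  if n is n'.+1 then red_q d n' * 'X * red_G_next d (red_s d n') (red_q d n')
  else \sum_(i < d - 1) 'C(d, i.+2)%:R * 'X^i.

(** Proportional to [calG d n.+1], see [calG_red_G]. The base case is separate because E_0 = - b d
    is not divisible by X^2. *)
Definition red_G (d n : nat) : {poly int} :=
  if n is n'.+1 then red_G_next d (red_s d n') (red_q d n') else red_q d 0.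

Lemma red_rS d n : red_r d n.+1 = ('X + 1) * d%:R * red_r d n * red_s d n ^+ (d - 1).
Proof. by rewrite /red_r /red_s /=; case: (red_rs d n). Qed.

Lemma red_sS d n : red_s d n.+1 = red_r d n ^+ d + (d - 1)%:R * red_s d n ^+ d.
Proof. by rewrite /red_r /red_s /=; case: (red_rs d n). Qed.

Lemma rs_red d n : (0 < d)%N ->
  rpoly d n.+1 = d%:R ^+ (d ^ n) * red_r d n /\
  spoly d n.+1 = d%:R ^+ (d ^ n) * red_s d n.
Proof.
case: d => // d _; elim: n => [|n [IHr IHs]].
  rewrite rpolyS spolyS /rpoly /spoly /red_r /red_s /= !expr1n subn1 /= expn0.
  by split; [ring | rewrite -natr1; ring].
rewrite !(rpolyS _ n.+1) !(spolyS _ n.+1) red_rS red_sS {}IHr {}IHs subn1 /= expnSr exprM.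
move: (_ ^+ (d.+1 ^ n)) (red_r _ _) (red_s _ _) => c r s.
by split; rewrite !exprMn [in c ^+ d.+1]exprS; ring.
Qed.

Lemma exprDn_tail (R : comPzRingType) (u t : R) (e : nat) :
  (u + t) ^+ e.+2 = u ^+ e.+2 + e.+2%:R * u ^+ e.+1 * t
    + t ^+ 2 * \sum_(i < e.+1) 'C(e.+2, i.+2)%:R * u ^+ (e - i) * t ^+ i.
Proof.
rewrite exprDn 2!big_ord_recl /= bin0 bin1 subn0 !mulr1 mulr1n expr1 subn1 /=.
rewrite addrA mulr_sumr; congr (_ + _ + _); first by rewrite -mulr_natl; ring.
apply: eq_bigr => i _; rewrite /bump /= !add1n !subSS -mulr_natl.
by rewrite !exprS; ring.
Qed.

Lemma red_s_next d n : (0 < d)%N -> red_s d n.+1 = red_E d n + red_t d (red_s d n).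
Proof.
case: d => // d _; rewrite red_sS /red_E /red_t subn1 /=.
move: (red_s _ _ ^+ _) (red_r _ _ ^+ _) => s r; rewrite -natr1; ring.
Qed.

(** Write E, r, s for level n and t for [red_t d s]. Then r_(n+1)^d = t^(d-1) (X + 1) d r^d with r^d
    = E + (X d + 1) s^d, and s_(n+1) = t + E. In the next E the terms t^d cancel, and t^(d-1) E gets
    the coefficient d (X + 1) - d (X d + 1) = - (d - 1) d X, which supplies a factor X; all other
    terms contain E^2 = E X^2 q. *)
Lemma red_E_sq d n : (1 < d)%N -> red_E d n = 'X^2 * red_q d n.
Proof.
case: d => [|[|e]] // _; elim: n => [|n IHn].
  rewrite /red_E /red_r /red_s /= expr1n (addrC 'X) exprDn_tail !expr1n subn1 /=.
  under eq_bigr do rewrite expr1n mulr1.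
  by move: (\sum_(i < _) _) => x; ring.
have -> : red_q e.+2 n.+1 =
    red_q e.+2 n * 'X * red_G_next e.+2 (red_s e.+2 n) (red_q e.+2 n) by [].
rewrite {1}/red_E red_s_next // red_rS IHn [in RHS]/red_G_next !subn1 /= subn2 /=.
have rE : red_r e.+2 n ^+ e.+2 =
    'X^2 * red_q e.+2 n + ('X * e.+2%:R + 1) * red_s e.+2 n ^+ e.+2.
  by rewrite -IHn /red_E; ring.
have -> : (('X + 1) * e.+2%:R * red_r e.+2 n * red_s e.+2 n ^+ e.+1) ^+ e.+2 =
    red_t e.+2 (red_s e.+2 n) ^+ e.+1 * ('X + 1) * e.+2%:R * red_r e.+2 n ^+ e.+2.
  have : (red_s e.+2 n ^+ e.+1) ^+ e.+2 = (red_s e.+2 n ^+ e.+2) ^+ e.+1.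
    by rewrite -[LHS]exprM -[RHS]exprM mulnC.
  rewrite /red_t; move: (red_s _ _ ^+ e.+1) (red_s _ _ ^+ e.+2) => a b ab.
  rewrite !exprMn ab; move: e.+2%:R (red_r _ _) => c r; rewrite !(exprS _ e.+1).
  by move: (_ ^+ _) (c ^+ _) (r ^+ _) (b ^+ _) => x1 x2 x3 x4; ring.
rewrite [in LHS](addrC ('X^2 * _)) exprDn_tail.
have -> : \sum_(i < e.+1) 'C(e.+2, i.+2)%:R * red_t e.+2 (red_s e.+2 n) ^+ (e - i) *
     ('X^(i.*2.+1) * red_q e.+2 n ^+ i.+1) = 'X * red_q e.+2 n *
     \sum_(i < e.+1) 'C(e.+2, i.+2)%:R * red_t e.+2 (red_s e.+2 n) ^+ (e - i) *
     ('X^2 * red_q e.+2 n) ^+ i.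
  rewrite mulr_sumr; apply: eq_bigr => i _.
  have -> : 'X^(i.*2.+1) = 'X * ('X^2) ^+ i :> {poly int}.
    by rewrite exprS -mul2n exprM.
  move: ('X^2) (red_t _ _ ^+ _) ('C(_, _)%:R) => y a b.
  rewrite exprMn (exprS _ i); move: (y ^+ i) (red_q _ _ ^+ i) => y1 q1; ring.
move: (\sum_(i < e.+1) _) => x; rewrite rE.
have uE : red_t e.+2 (red_s e.+2 n) = ('X + 1) * e.+2%:R * red_s e.+2 n ^+ e.+2 by [].
rewrite (exprS (red_t _ _) e.+1).
move: (red_t _ _ ^+ e.+1) uE => v; move: (red_t _ _) (red_s _ _ ^+ _) (red_q _ _) => u s q ->.
rewrite -[e.+2%:R]natr1. ring.
Qed.

Lemma red_E_next d n : (1 < d)%N -> red_E d n.+1 = red_E d n * ('X * red_G d n.+1).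
Proof. by move=> d1; rewrite !red_E_sq //= !mulrA. Qed.

(** * The Newton polygon at d *)

(** The number (d^n - 1) / (d - 1), which is the valuation of the constant coefficient of
    [red_s d n]. *)
Fixpoint repunit (d n : nat) : nat :=
  if n is n'.+1 then (1 + d * repunit d n')%N else 0%N.

Lemma repunitE d n : (0 < d)%N -> ((d - 1) * repunit d n + 1 = d ^ n)%N.
Proof.
case: d => // d _; elim: n => [|n IHn] /=; first by rewrite muln0.
rewrite expnS -IHn subn1 /=; ring.
Qed.

(** Since [red_E] vanishes at 0, only [red_t] contributes: s_(n+1)(0) = d s_n(0)^d. *)
Lemma red_s_coef0 d n : (1 < d)%N -> (red_s d n)`_0 = (d ^ repunit d n)%:Z.
Proof.
move=> d1; elim: n => [|n IHn]; first by rewrite /red_s /= coef1.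
rewrite red_s_next; last lia.
rewrite red_E_sq // coefD -!horner_coef0 hornerM hornerXn expr0n mul0r add0r.
rewrite /red_t -polyC_natr !hornerE ?horner_exp horner_coef0 IHn /=.
by rewrite expnD expn1 mulnC [(d * _)%N]mulnC expnM -!natz !natrM !natrX mulrC.
Qed.

(** For n = 0 the coefficient is C(d, 2), of valuation 1 because d is odd. For n > 0 only the first
    term of [red_G_next] survives at 0, with valuation 1 + (d - 1) [repunit d n] = d^n. *)
Lemma red_G_coef0 d n : prime d -> (2 < d)%N ->
  (red_G d n)`_0 != 0 /\ logn d `|(red_G d n)`_0| = (d ^ n)%N.
Proof.
move=> d_prime d3; have d1 : (1 < d)%N by lia.
have d_d1 : coprime d (d - 1) by rewrite coprime_sym subn1 coprimePn //; lia.
case: n => [|n] /=.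
  have -> : (\sum_(i < d - 1) 'C(d, i.+2)%:R * 'X^i : {poly int})`_0 = 'C(d, 2)%:Z.
    rewrite -(@prednK (d - 1)); last lia.
    rewrite big_ord_recl /= coefD expr0 mulr1 -polyC_natr coefC /= natz.
    rewrite coef_sum big1 ?addr0 // => i _.
    by rewrite -polyC_natr coefCM coefXn /= mulr0.
  have C0 : (0 < 'C(d, 2))%N by rewrite bin_gt0.
  split; first by rewrite eqz_nat -lt0n.
  have : (2 * 'C(d, 2) = d * (d - 1))%N.
    rewrite bin2 mul2n subn1 -[RHS]odd_double_half.
    suff -> : odd (d * d.-1) = false by [].
    by case: (d) d3 => // e _; rewrite oddM /= andNb.
  move/(congr1 (logn d)); rewrite lognM // lognM //; [|lia..].
  rewrite (logn_prime d d_prime) eqxx (logn_coprime d_d1) => e2; rewrite expn0 -[RHS]e2.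
  by rewrite (@logn_coprime d 2) // prime_coprime // gtnNdvd.
have -> : (red_G_next d (red_s d n) (red_q d n))`_0 =
    - ((d - 1) * d * (d * (d ^ repunit d n) ^ d) ^ (d - 1))%:Z.
  rewrite /red_G_next coefD coefN [X in _ + X]coefN -!horner_coef0.
  rewrite [X in _ - X]hornerM horner_sum [X in _ - _ * X]big1 ?mulr0 ?subr0; last first.
    by move=> i _; rewrite !hornerM hornerXn expr0n mul0r mulr0.
  rewrite /red_t -!polyC_natr !(hornerE, horner_exp).
  rewrite horner_coef0 red_s_coef0 // -!natz /=.
  by rewrite !natrM !natrX natrM !natrX; ring.
split; first by rewrite oppr_eq0 eqz_nat -lt0n !muln_gt0 !expn_gt0 muln_gt0 expn_gt0; lia.
rewrite abszN absz_nat.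
rewrite -mulnA logn_Gauss // -expnM -expnS -expnM -expnS pfactorK //.
rewrite -(repunitE d n.+1) //=; [ring | lia].
Qed.

Lemma bin_mid_Fp d i : prime d -> (i < d - 2)%N -> 'C(d, i.+2)%:R = 0 :> 'F_d.
Proof.
move=> d_prime i_lt.
have /dvdnP[k ->] : (d %| 'C(d, i.+2))%N by apply: prime_dvd_bin => //; lia.
by rewrite natrM pchar_Fp_0 // mulr0.
Qed.

Local Notation modp d := (map_poly (intr : int -> 'F_d)).

(** Modulo d only the summand i = d - 2 survives, its binomial coefficient being C(d, d) = 1. *)
Lemma red_G_next_modp d s q : prime d -> (2 < d)%N ->
  modp d (red_G_next d s q) = - ('X^((d - 2).*2.+1) * modp d q ^+ (d - 1)).
Proof.
move=> d_prime d3; have d0 : d%:R = 0 :> {poly 'F_d}.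
  by rewrite -polyC_natr pchar_Fp_0.
rewrite /red_G_next rmorphB rmorphN !rmorphM rmorphD !rmorphM !rmorph_nat rmorph1 d0.
rewrite !(mulr0, mul0r) oppr0 !sub0r add0r mul1r.
have -> : (d - 1 = (d - 2).+1)%N by lia.
rewrite big_ord_recr rmorphD rmorph_sum /= big1 ?add0r => [|i _].
  rewrite !rmorphM !rmorphXn /= map_polyX rmorph_nat.
  have -> : (d - 2).+2 = d by lia.
  by rewrite binn subnn expr0 !mul1r.
by rewrite !rmorphM rmorph_nat -polyC_natr bin_mid_Fp // !mul0r.
Qed.

(** Modulo d the recursion reads q -> - X^(2d-2) q^d, which takes the exponent D - 2 to d D - 2. *)
Lemma red_q_modp d n : prime d -> (2 < d)%N ->
  exists2 c, c != 0 & modp d (red_q d n) = c *: 'X^(d ^ n.+1 - 2).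
Proof.
move=> d_prime d3; elim: n => [|n [c c0 IHn]].
  exists 1; rewrite ?oner_eq0 // scale1r expn1 /=.
  have -> : (d - 1 = (d - 2).+1)%N by lia.
  rewrite big_ord_recr rmorphD rmorph_sum /= big1 ?add0r => [|i _].
    rewrite rmorphM rmorphXn /= map_polyX rmorph_nat.
    have -> : (d - 2).+2 = d by lia.
    by rewrite binn mul1r.
  by rewrite rmorphM rmorph_nat -polyC_natr bin_mid_Fp // !mul0r.
exists (- c ^+ d); first by rewrite oppr_eq0 expf_eq0 (negPf c0) andbF.
rewrite /= !rmorphM /= map_polyX red_G_next_modp // {}IHn exprZn -exprM.
rewrite scaleNr !mulrN -!scalerAr -!scalerAl scalerA -exprSr.
have -> : (d - 1).+1 = d by lia.
congr (- (_ *: _)); rewrite -exprSr -!exprD; congr ('X^ _).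
have : (2 < d ^ n.+1)%N by rewrite (leq_trans d3) // -{1}(expn1 d) leq_pexp2l //; lia.
by rewrite (expnS d n.+1); move: (d ^ n.+1)%N => D D3; nia.
Qed.

Lemma red_G_modp d n : prime d -> (2 < d)%N ->
  exists2 c, c != 0 & modp d (red_G d n) = c *: 'X^((d - 1) * d ^ n - 1).
Proof.
move=> d_prime d3; case: n => [|n].
  have [c c0 cE] := red_q_modp d 0 d_prime d3; exists c => //.
  rewrite expn1 in cE; rewrite cE expn0 muln1; congr (_ *: 'X^ _); lia.
have [c c0 cE] := red_q_modp d n d_prime d3.
exists (- c ^+ (d - 1)); first by rewrite oppr_eq0 expf_eq0 (negPf c0) andbF.
rewrite /= red_G_next_modp // cE exprZn -exprM scaleNr -scalerAr -exprD.
congr (- (_ *: 'X^ _)).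
have : (2 < d ^ n.+1)%N by rewrite (leq_trans d3) // -{1}(expn1 d) leq_pexp2l //; lia.
by move: (d ^ n.+1)%N => D D3; nia.
Qed.

Lemma Fp_dvdz d (c : int) : prime d -> (d %| c)%Z -> c%:~R = 0 :> 'F_d.
Proof.
move=> d_prime /dvdzP[k ->]; rewrite rmorphM /= -[d%:Z]natz.
by rewrite rmorph_nat pchar_Fp_0 // mulr0.
Qed.

Lemma red_G_coef_unit d n : prime d -> (2 < d)%N ->
  ~~ (d %| (red_G d n)`_((d - 1) * d ^ n - 1))%Z.
Proof.
move=> d_prime d3; have [c c0 cE] := red_G_modp d n d_prime d3.
apply: contra c0 => /(Fp_dvdz _ _ d_prime).
by rewrite -coef_map /= cE coefZ coefXn eqxx mulr1 => ->.
Qed.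

(** After multiplication by j + k it remains to compare D j with N k, and D j <= h j <= N. It is
    applied with j = d - 2 - i and k = i + 1. *)
Lemma slope_bound N h D r j k : (D <= h -> 0 < k -> (j + k) * r + 1 = D ->
  N + 1 = (j + k) * h -> h * D * j <= N + N * r * j)%N.
Proof.
move=> D_le k0 rE NE; have D0 : (0 < D)%N by rewrite -rE addn1.
have Dj : (D * j <= N)%N.
  have : (D * j <= h * j)%N by rewrite leq_mul2r D_le orbT.
  have : (h <= k * h)%N by rewrite leq_pmull.
  by move: NE; rewrite mulnDl [(j * h)%N]mulnC; lia.
have jk0 : (0 < j + k)%N by lia.
rewrite -(leq_pmul2l jk0).
have -> : ((j + k) * (h * D * j) = N * (D * j) + D * j)%N.
  by rewrite -{2}[(D * j)%N]mul1n -mulnDl NE; ring.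
have -> : ((j + k) * (N + N * r * j) = N * k + N * (D * j))%N by rewrite -rE; ring.
by rewrite addnC leq_add2r (leq_trans Dj) // leq_pmulr.
Qed.

Section NewtonPolygon.

Variables (d h : nat).
Hypotheses (d_prime : prime d) (d_gt2 : (2 < d)%N) (h_gt0 : (0 < h)%N).

Let N := ((d - 1) * h - 1)%N.

Local Notation wge := (weight_ge d N h).

Let N_gt0 : (0 < N)%N.
Proof. by rewrite /N; nia. Qed.

Lemma weight_ge_bin i : (i < d - 2)%N -> wge N ('C(d, i.+2)%:R).
Proof.
move=> i_lt; apply: (@weight_ge_nat _ _ _ N_gt0 _ _ 1); last by rewrite muln1.
by rewrite expn1 prime_dvd_bin //; lia.
Qed.

Lemma weight_ge_red_q0 : wge (h * (d - 2)) (red_q d 0).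
Proof.
apply: weight_ge_sum => // -[i /= i_le] _.
(* Below the top term the binomial is divisible by d, which alone gives weight N >= h (d - 2). *)
have [i_lt|i_ge] := ltnP i (d - 2).
  apply: (weight_geM _ _ _ N_gt0 N (h * i)); last 2 first.
  - exact: weight_ge_bin.
  - exact: weight_geXn.
  by rewrite /N; nia.
have -> : i = (d - 2)%N by lia.
apply: (weight_geM _ _ _ N_gt0 0 (h * (d - 2))) => //; first exact: weight_ge0.
exact: weight_geXn.
Qed.

Lemma weight_ge_red_t s n :
  wge (N * repunit d n) s -> wge (N * repunit d n.+1) (red_t d s).
Proof.
move=> ws; rewrite /red_t -mulrA.
apply: (weight_geM _ _ _ N_gt0 0 (N * repunit d n.+1)) => //.
  exact: weight_ge0.
apply: (weight_geM _ _ _ N_gt0 N (N * repunit d n * d)).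
- by rewrite /=; nia.
- by apply: (@weight_ge_nat _ _ _ N_gt0 _ _ 1); rewrite ?expn1 ?muln1.
- exact: weight_geX.
Qed.

Lemma red_G_next_term_bound D r i : (D <= h)%N -> ((d - 1) * r + 1 = D)%N ->
  (i < d - 2)%N -> (h * ((d - 1) * D - 1) <=
    N + N * r * (d - 2 - i) + h * (D * i.+1 - 1))%N.
Proof.
move=> D_le rE i_lt; have D_gt0 : (0 < D)%N by rewrite -rE addn1.
have dE : (d - 1 = (d - 2 - i) + i.+1)%N by lia.
have NE : (N + 1 = (d - 1) * h)%N by rewrite /N subnK // muln_gt0; lia.
rewrite dE in rE NE *; move: (d - 2 - i)%N i.+1 (ltn0Sn i) rE NE => j k k0 rE NE.
have := slope_bound _ _ _ _ _ _ D_le k0 rE NE.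
have -> : ((j + k) * D - 1 = D * j + (D * k - 1))%N.
  by rewrite mulnDl addnBA ?muln_gt0 ?D_gt0 // [(j * D)%N]mulnC [(k * D)%N]mulnC.
by rewrite mulnDr mulnA leq_add2r.
Qed.

Lemma weight_ge_red_G_next s q n : (d ^ n.+1 <= h)%N ->
  wge (N * repunit d n) s -> wge (h * (d ^ n.+1 - 2)) q ->
  wge (h * ((d - 1) * d ^ n.+1 - 1)) (red_G_next d s q).
Proof.
move=> D_le /weight_ge_red_t ws wq.
have d_gt0 : (0 < d)%N by lia.
have rE := repunitE d n.+1 d_gt0; move: (repunit d n.+1) rE ws => r rE ws.
have D_gt2 : (2 < d ^ n.+1)%N.
  by rewrite (leq_trans d_gt2) // -{1}(expn1 d) leq_pexp2l.
move: (d ^ n.+1)%N D_le rE wq D_gt2 => D D_le rE wq D_gt2.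
have NE : (N + 1 = (d - 1) * h)%N by rewrite /N; nia.
apply: weight_geD => //; apply: weight_geN => //.
  (* The available weight is N D and the required one is (N + 1) D - h, so D <= h suffices. *)
  apply: (weight_geM _ _ _ N_gt0 N (N * r * (d - 1))).
  - have : (N * r * (d - 1) + N = N * D)%N by rewrite -rE; ring.
    have : (h * ((d - 1) * D - 1) + h = (N + 1) * D)%N.
      by rewrite NE; nia.
    by rewrite mulnDl mul1n; lia.
  - apply: (weight_geM _ _ _ N_gt0 0 N) => //; first exact: weight_ge0.
    by apply: (@weight_ge_nat _ _ _ N_gt0 _ _ 1); rewrite ?expn1 ?muln1.
  - exact: weight_geX.
apply: (weight_geM _ _ _ N_gt0 0 (h * ((d - 1) * D - 1))) => //.
  exact: weight_ge0.
apply: weight_ge_sum => // -[i /= i_le] _.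
have wXq : wge (h * (D * i.+1 - 1)) ('X^(i.*2.+1) * q ^+ i.+1).
  apply: (weight_geM _ _ _ N_gt0 (h * i.*2.+1) (h * (D - 2) * i.+1)).
  - by nia.
  - exact: weight_geXn.
  - exact: weight_geX.
(* For i < d - 2 the binomial contributes a factor d; for i = d - 2 the power of q alone meets the
   bound exactly. *)
have [i_lt|i_ge] := ltnP i (d - 2).
  apply: (weight_geM _ _ _ N_gt0 (N + N * r * (d - 2 - i)) (h * (D * i.+1 - 1))) => //.
    by apply: red_G_next_term_bound.
  apply: (weight_geM _ _ _ N_gt0 N (N * r * (d - 2 - i))) => //.
    exact: weight_ge_bin.
  exact: weight_geX.
have iE : i = (d - 2)%N by lia.
apply: (weight_geM _ _ _ N_gt0 0 (h * (D * i.+1 - 1))) => //.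
  by rewrite iE add0n mulnC (_ : (d - 2).+1 = d - 1)%N //; lia.
exact: weight_ge0.
Qed.

(** The slope h / N is set by the final level h = d^n, but the earlier levels must be bounded with
    the same slope. Hence the induction fixes h and only asks for d^n <= h. *)
Lemma weight_ge_red n : (d ^ n <= h)%N ->
  [/\ wge (N * repunit d n) (red_s d n), wge (h * (d ^ n.+1 - 2)) (red_q d n) &
      wge (h * ((d - 1) * d ^ n - 1)) (red_G d n)].
Proof.
have D_gt2 k : (2 < d ^ k.+1)%N.
  by rewrite (leq_trans d_gt2) // -{1}(expn1 d) leq_pexp2l //; lia.
elim: n => [_|n IHn D_le].
  rewrite expn1 expn0 muln1 -subnDA; split; try exact: weight_ge_red_q0.
  by rewrite muln0; apply: weight_ge0.
have [|ws wq _] := IHn.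
  by rewrite (leq_trans _ D_le) // leq_pexp2l //; lia.
have wg := weight_ge_red_G_next _ _ _ D_le ws wq; split=> //.
- rewrite red_s_next ?red_E_sq; [|lia..]; apply: weight_geD => //; last first.
    exact: weight_ge_red_t.
  apply: (weight_geM _ _ _ N_gt0 (h * 2) (h * (d ^ n.+1 - 2))) => //; last first.
    exact: weight_geXn.
  have d_gt0 : (0 < d)%N by lia.
  have := repunitE d n.+1 d_gt0; have := D_gt2 n; rewrite -mulnDr.
  move: (repunit d n.+1) (d ^ n.+1)%N => r D D3 rE.
  rewrite subnKC; last lia.
  (* Multiplication by d - 1 turns r into D - 1. *)
  rewrite -(@leq_pmul2l (d - 1)); last lia.
  have -> : ((d - 1) * (N * r) = N * (D - 1))%N by rewrite -rE addnK; ring.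
  by rewrite mulnA /N; nia.
- apply: (weight_geM _ _ _ N_gt0 (h * (d ^ n.+1 - 1)) (h * ((d - 1) * d ^ n.+1 - 1))) => //.
    rewrite -mulnDr leq_mul2l; apply/orP; right; rewrite (expnS d n.+1).
    by have := D_gt2 n; move: (d ^ n.+1)%N => D; nia.
  apply: (weight_geM _ _ _ N_gt0 (h * (d ^ n.+1 - 2)) (h * 1)) => //; last first.
    by rewrite -['X]expr1; apply: weight_geXn.
  by rewrite -mulnDr leq_mul2l; have := D_gt2 n; lia.
Qed.

End NewtonPolygon.

(** * Degrees *)

(** Positive leading coefficients exclude cancellation, so the degree of a sum is the maximum
    ([posdegD]). *)
Definition posdeg (P : {poly int}) (a : nat) : Prop :=
  size P = a.+1 /\ 0 < lead_coef P.

Lemma posdegM P Q a b : posdeg P a -> posdeg Q b -> posdeg (P * Q) (a + b).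
Proof.
move=> [sP lP] [sQ lQ]; split; last by rewrite lead_coefM mulr_gt0.
by rewrite size_mul ?sP ?sQ ?addnS // -lead_coef_eq0 gt_eqF.
Qed.

Lemma posdegX P a n : posdeg P a -> posdeg (P ^+ n) (a * n).
Proof.
move=> Pa; elim: n => [|n IHn]; last by rewrite exprS mulnS; apply: posdegM.
by rewrite muln0 expr0 /posdeg size_poly1 lead_coef1.
Qed.

Lemma posdeg_nat n : (0 < n)%N -> posdeg n%:R 0.
Proof.
move=> n0; rewrite -polyC_natr /posdeg size_polyC lead_coefC ltr0n n0.
by rewrite pnatr_eq0 -lt0n n0.
Qed.

Lemma posdegD P Q a b : posdeg P a -> posdeg Q b -> posdeg (P + Q) (maxn a b).
Proof.
move=> [sP lP] [sQ lQ]; have [ab|ab|ab] := ltngtP a b.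
- by rewrite addrC /posdeg size_polyDl ?lead_coefDl ?sP ?sQ //; split=> //; lia.
- by rewrite /posdeg size_polyDl ?lead_coefDl ?sP ?sQ //; split=> //; lia.
subst b; have c0 : (P + Q)`_a != 0.
  rewrite coefD; move: lP lQ; rewrite !lead_coefE sP sQ /= => lP lQ.
  by rewrite gt_eqF // addr_gt0.
have sPQ : size (P + Q) = a.+1.
  apply/eqP; rewrite eqn_leq (leq_trans (size_polyD _ _)) ?sP ?sQ ?maxnn //.
  by rewrite ltnNge; apply: contra c0 => /leq_sizeP ->.
split=> //; rewrite lead_coefE sPQ coefD.
by move: lP lQ; rewrite !lead_coefE sP sQ /= => lP lQ; rewrite addr_gt0.
Qed.

Lemma posdeg_XD1 : posdeg ('X + 1) 1.
Proof. by rewrite /posdeg -[1]opprK -polyC1 -polyCN size_XsubC lead_coefXsubC. Qed.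

Lemma posdeg_XMnatD1 n : (0 < n)%N -> posdeg ('X * n%:R + 1) 1.
Proof.
move=> n0; apply: (posdegD _ _ 1 0); last exact: (posdeg_nat 1).
apply: (posdegM _ _ 1 0); last exact: posdeg_nat.
by rewrite /posdeg size_polyX lead_coefX.
Qed.

(* x = deg red_r - deg red_s + d - 1 runs cyclically through 1, ..., d. *)
Lemma red_rs_degree d n : (1 < d)%N ->
  exists x a b, [/\ (1 <= x <= d)%N /\ (a + (d - 1) = b + x)%N,
    ((d ^ d - 1) * b + d ^ x = d ^ (d + n.+1))%N, ((n.+1 <= d)%N -> x = n.+1),
    posdeg (red_r d n.+1) a & posdeg (red_s d n.+1) b].
Proof.
move=> d1; have d0 : (0 < d)%N by lia.
have dd0 : (0 < d ^ d)%N by rewrite expn_gt0 d0.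
have dP : posdeg d%:R 0 by apply: posdeg_nat.
have d1P : posdeg (d - 1)%:R 0 by apply: posdeg_nat; lia.
elim: n => [|n [x [a [b [[x_le abE] bE xE ra sb]]]]].
  exists 1%N, 2%N, d; split=> //; first by lia.
  - by rewrite expn1 mulnBl mul1n subnK ?leq_pmull // -expnSr addn1.
  - rewrite red_rS /red_r /red_s /= expr1n mulr1.
    exact: (posdegM _ _ _ _ (posdegM _ _ _ _ posdeg_XD1 dP) posdeg_XD1).
  - rewrite red_sS /red_r /red_s /= expr1n mulr1 -[X in posdeg _ X]maxn0.
    by apply: posdegD => //; rewrite -[X in posdeg _ X]mul1n; apply/posdegX/posdeg_XD1.
have ra' : posdeg (red_r d n.+2) (1 + 0 + a + b * (d - 1)).
  by rewrite red_rS; do !apply: posdegM => //; [exact: posdeg_XD1 | exact: posdegX].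
have sb' : posdeg (red_s d n.+2) (maxn (a * d) (0 + b * d)).
  rewrite red_sS; apply: posdegD; first exact: posdegX.
  by apply: posdegM => //; apply: posdegX.
(* While x < d one has a <= b, so s^d determines the next degree. At x = d, a = b + 1 and r^d wins,
   which adds d to the degree and resets x to 1. *)
have [x_lt|x_ge] := ltnP x d.
  exists x.+1, (1 + 0 + a + b * (d - 1))%N, (b * d)%N; split=> //.
  - split; first lia.
    have : (b * (d - 1) + b = b * d)%N by rewrite -{2}(muln1 b) -mulnDr subnK.
    by lia.
  - by rewrite mulnA (expnSr d x) -mulnDl bE -expnSr -addnS.
  - by move=> n_lt; rewrite xE //; lia.
  - move: sb'; rewrite add0n (maxn_idPr _) // leq_mul2r; apply/orP; right; lia.
have {x_ge}xd : x = d by lia.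
exists 1%N, (1 + 0 + a + b * (d - 1))%N, (a * d)%N; split=> //.
- split; first lia.
  have : (b * (d - 1) + b = b * d)%N by rewrite -{2}(muln1 b) -mulnDr subnK.
  have -> : (a = b + 1)%N by lia.
  by rewrite mulnDl; lia.
- have -> : (a = b + 1)%N by lia.
  rewrite (addnS d n.+1) (expnSr d (d + n.+1)) -bE xd expn1 mulnA mulnDr muln1.
  by rewrite -[X in (_ + X = _)%N]mul1n -mulnDl -addnA subnK.
- by move=> n_lt; have := xE (ltnW n_lt); lia.
- move: sb'; rewrite add0n (maxn_idPl _) // leq_mul2r; apply/orP; right; lia.
Qed.

(** For x < d the term (X d + 1) s^d dominates and gives one more than the degree of the next s; for
    x = d the term r^d dominates and the degrees agree. *)
Lemma red_E_degree d n : (1 < d)%N ->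
  (pdeg (red_s d n.+2) <= pdeg (red_E d n.+1) <= pdeg (red_s d n.+2) + 1)%N /\
  ((n.+1 < d)%N -> pdeg (red_E d n.+1) = (d ^ n.+2 + 1)%N).
Proof.
move=> d1; have d0 : (0 < d)%N by lia.
have [x [a [b [[x_le abE] bE xE ra sb]]]] := red_rs_degree d n d1.
have sb' : posdeg (red_s d n.+2) (maxn (a * d) (0 + b * d)).
  rewrite red_sS; apply: posdegD; first exact: posdegX.
  by apply: posdegM; [apply: posdeg_nat; lia | apply: posdegX].
have [s1 _] := posdegX _ _ d ra.
have [s2 _] := posdegM _ _ _ _ (posdeg_XMnatD1 d d0) (posdegX _ _ d sb).
rewrite /pdeg sb'.1 add0n /red_E /=.
have [x_lt|x_ge] := ltnP x d.
  have ab : (a * d <= b * d)%N by rewrite leq_mul2r; apply/orP; right; lia.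
  rewrite (maxn_idPr ab) addrC size_polyDl size_polyN s2 /= ?s1; last by lia.
  split=> [|n_lt]; first by lia.
  rewrite addnC; congr (_ + 1)%N; rewrite (expnSr d n.+1); congr (_ * d)%N.
  move: bE; rewrite xE; last lia.
  rewrite expnD mulnBl mul1n => bE; apply/eqP.
  have dd : (1 < d ^ d)%N by rewrite -{1}(expn0 d) ltn_exp2l.
  have : ((d ^ d - 1) * b = (d ^ d - 1) * d ^ n.+1)%N.
    by rewrite !mulnBl !mul1n -bE addnK.
  by move/eqP; rewrite eqn_pmul2l // subn_gt0.
have ab : (b * d + d = a * d)%N by rewrite addnC -mulSn; congr (_ * d)%N; lia.
rewrite (maxn_idPl _); last by lia.
rewrite size_polyDl; last by rewrite size_polyN s1 s2; lia.
rewrite s1 /=.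
split=> [|n_lt]; first by lia.
by have := xE (ltnW n_lt); lia.
Qed.

Lemma pdeg_red_E_next d n : (1 < d)%N -> red_E d n != 0 -> red_G d n.+1 != 0 ->
  (pdeg (red_E d n.+1) = pdeg (red_E d n) + 1 + pdeg (red_G d n.+1))%N.
Proof.
move=> d1 E0 g0; rewrite red_E_next // /pdeg size_mul ?mulf_neq0 ?polyX_eq0 //.
rewrite size_mul ?polyX_eq0 // size_polyX.
move: E0 g0; rewrite -!size_poly_gt0; case: (size _) => // ?; case: (size _) => // ?.
by rewrite /= !(addnS, addSn) /=; lia.
Qed.

(** * Comparison with the original polynomials, and the large factor *)

Definition Epoly (d m : nat) : {poly int} :=
  rpoly d m ^+ d - ('X * d%:R + 1) * spoly d m ^+ d.

Lemma Epoly_red_E d n : (0 < d)%N ->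
  Epoly d n.+1 = d%:R ^+ (d ^ n.+1) * red_E d n.
Proof.
move=> d0; have [rE sE] := rs_red d n d0.
rewrite /Epoly rE sE /red_E !exprMn -exprM -expnSr; ring.
Qed.

(** This identifies the denominator in [calG] as E_(m-1). *)
Lemma spoly_diff d n : (0 < d)%N ->
  spoly d n.+1 - ('X + 1) * d%:R * spoly d n ^+ d = Epoly d n.
Proof.
case: d => // d _; rewrite spolyS /Epoly subn1 /=.
move: (spoly _ _ ^+ _) (rpoly _ _ ^+ _) => s r; rewrite -natr1; ring.
Qed.

(** The d-th power of (b + 1) d s^d cancels the s-part of E_n, leaving r_(n+1)^d. With [calG_spec]
    and [spoly_diff] this gives b d G_m E_(m-1) = E_m. *)
Lemma Epoly_next d n : (0 < d)%N ->
  ('X + 1) ^+ d * d%:R ^+ d * spoly d n ^+ (d * (d - 1)) * Epoly d n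
    - ('X * d%:R + 1)
      * (spoly d n.+1 ^+ d - (('X + 1) * d%:R * spoly d n ^+ d) ^+ d)
  = Epoly d n.+1.
Proof.
move=> d0; rewrite /Epoly rpolyS.
have sE : (spoly d n ^+ d) ^+ d = spoly d n ^+ (d * (d - 1)) * spoly d n ^+ d.
  by rewrite -exprD -mulnSr -exprM subn1 prednK.
have rE : (spoly d n ^+ (d - 1)) ^+ d = spoly d n ^+ (d * (d - 1)).
  by rewrite -exprM mulnC.
move: (spoly d n ^+ d) (spoly d n ^+ (d - 1)) sE rE => s1 s2.
rewrite !exprMn => -> ->.
by move: (_ ^+ (d * (d - 1))) (d%:R ^+ d) (_ ^+ d) (rpoly d n ^+ d) => *; ring.
Qed.

Lemma red_E_neq0 d n : (1 < d)%N -> red_E d n != 0.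
Proof.
move=> d1; have d0 : (0 < d)%N by lia.
(* At m = n + 2 the nonzero difference is E_(n+1). *)
have [nz _] := calG_spec d1 (ltn0Sn n.+1).
rewrite subn1 /= spoly_diff // Epoly_red_E // mulf_eq0 negb_or in nz.
by case/andP: nz.
Qed.

Lemma calG_red_G d n : (1 < d)%N ->
  exists2 c : rat, c != 0 & calG d n.+1 = c *: map_poly intr (red_G d n).
Proof.
move=> d1; have d0 : (0 < d)%N by lia.
have [_ [P PE]] := calG_spec d1 (ltn0Sn n).
rewrite subn1 /= spoly_diff // Epoly_next // => spec.
have dX k : ((d%:R ^+ k)%:P : {poly int}) = d%:R ^+ k by rewrite polyC_exp polyC_natr.
have dk0 k : (d%:R ^+ k : int) != 0 by rewrite expf_neq0 // pnatr_eq0 -lt0n.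
suff [a [b [a0 b0 abE]]] :
    exists a b : int, [/\ a != 0, b != 0 & a *: P = b *: red_G d n].
  exists (b%:~R / a%:~R); first by rewrite mulf_neq0 ?invr_eq0 ?intr_eq0.
  have a0' : (a%:~R : rat) != 0 by rewrite intr_eq0.
  rewrite PE; apply: (scalerI a0'); rewrite scalerA mulrCA divff // mulr1.
  by rewrite -!map_polyZ /= abE.
have X0 : ('X : {poly int}) != 0 by rewrite polyX_eq0.
rewrite Epoly_red_E // in spec.
(* For m = 1 the divisor E_0 = - d X falls outside [Epoly_red_E]; with the factor d X of [calG_spec]
   it produces the constant - d^2. *)
case: n => [|n] in PE spec *.
  exists (- d%:R ^+ 2), (d%:R ^+ (d ^ 1)); split; rewrite ?oppr_eq0 //.
  apply: (mulfI X0); apply: (mulfI X0).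
  move: spec; rewrite red_E_sq // /Epoly /rpoly /spoly /= !expr1n mulr1.
  rewrite -!mul_polyC polyCN !dX -/(red_q d 0).
  move: (d%:R ^+ (d ^ 1)) (red_q d 0) => c q spec.
  have -> : 'X * ('X * (c * q)) = c * ('X^2 * q) by ring.
  by rewrite -spec; ring.
exists (d%:R ^+ (d ^ n.+1).+1), (d%:R ^+ (d ^ n.+2)); split=> //.
apply: (mulfI (red_E_neq0 d n d1)); apply: (mulfI X0).
move: spec; rewrite red_E_next // Epoly_red_E // -!mul_polyC !dX exprS.
move: (d%:R ^+ (d ^ n.+1)) (d%:R ^+ (d ^ n.+2)) (red_E d n) (red_G d n.+1) => c c' e g spec.
have -> : 'X * (e * (c' * g)) = c' * (e * ('X * g)) by ring.
by rewrite -spec; ring.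
Qed.

(** The condition on A gives degree at least N; the one on B serves to exclude a linear cofactor in
    [red_G1_no_linear_factor]. *)
Lemma red_G_irreducible_factor d n : prime d -> (2 < d)%N ->
  exists A B : {poly int}, [/\ red_G d n = A * B,
    irreducible_poly (map_poly (intr : int -> rat) A),
    ~~ (d %| A`_((d - 1) * d ^ n - 1))%Z & ~~ (d %| B`_0)%Z].
Proof.
move=> d_prime d3; have dn0 : (0 < d ^ n)%N by rewrite expn_gt0; lia.
set N := ((d - 1) * d ^ n - 1)%N.
have N1 : (N + 1 = (d - 1) * d ^ n)%N by rewrite subnK // muln_gt0 dn0; lia.
have N0 : (0 < N)%N.
  have : ((d - 1) * 1 <= (d - 1) * d ^ n)%N by rewrite leq_mul2l dn0 orbT.
  by lia.
have gN := red_G_coef_unit d n d_prime d3; have [g0 vg0] := red_G_coef0 d n d_prime d3.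
have size_gt (P : {poly int}) : ~~ (d %| P`_N)%Z -> (N < size P)%N.
  by move=> PN; rewrite ltnNge; apply: contra PN => /leq_sizeP ->; rewrite ?dvdz0.
have [_ _ wg] := weight_ge_red d (d ^ n) d_prime d3 dn0 n (leqnn _).
have g0d : (d %| (red_G d n)`_0)%Z.
  by rewrite dvdzE -[X in (X %| _)%N]expn1 pfactor_dvdn ?absz_gt0 // vg0.
have [|A [B [gE A0 irrA]]] :=
  irreducible_factor_dvd_const d d_prime (red_G d n) _ g0d.
  exact: leq_ltn_trans N0 (size_gt _ gN).
(* N + 1 is a multiple of d^n. *)
have co : coprime N (d ^ n).
  apply: (@coprime_dvdr _ N.+1); last exact: coprimenS.
  by rewrite -addn1 N1 dvdn_mull.
have [[nA0 _]|[AN B0]] := dumas d N (d ^ n) d_prime _ A B co wg g0 vg0 gN gE.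
  by rewrite A0 in nA0.
by exists A, B.
Qed.

(** * Preperiod two *)

Lemma dvdz_prime_exp p (a : int) k : prime p -> (p %| a ^+ k)%Z -> (p %| a)%Z.
Proof. by move=> pp; rewrite !dvdzE abszX Euclid_dvdX // => /andP[]. Qed.

(** The first bound gives al >= d^(d+1), whence al^d >= al^3 >= 2 al^2 >= y + al > y + (d - 1)
    d^d. *)
Lemma preperiod2_size d (al y : nat) : (2 < d)%N ->
  (d ^ d.+3 <= al + (d - 1))%N -> (y <= al ^ 2)%N ->
  (al ^ d <= y + (d - 1) * d ^ d)%N -> False.
Proof.
move=> d3 al_ge y_le al_le; have d0 : (0 < d)%N by lia.
have dd0 : (0 < d ^ d)%N by rewrite expn_gt0 d0.
have al1 : (d * d ^ d <= al)%N.
  rewrite -expnS; have : (d ^ d.+1 + (d - 1) <= d ^ d.+3)%N.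
    rewrite -(addn2 d.+1) expnD expnS.
    have : (d <= d * d ^ d)%N by rewrite leq_pmulr.
    move: (d * d ^ d)%N => z dz.
    have : (z * 2 <= z * d ^ 2)%N.
      rewrite leq_mul2l; apply/orP; right.
      by rewrite (leq_trans (ltnW d3)) // -{1}(expn1 d) leq_pexp2l.
    lia.
  by lia.
have al2 : (2 <= al)%N by apply: leq_trans al1; rewrite (leq_trans (ltnW d3)) // leq_pmulr.
have : (al ^ 3 <= al ^ d)%N by rewrite leq_pexp2l //; lia.
have : (2 * al ^ 2 <= al ^ 3)%N by rewrite (expnS al 2) leq_mul2r al2 orbT.
have : (al <= al ^ 2)%N by rewrite -{1}(expn1 al) leq_pexp2l //; lia.
have : ((d - 1) * d ^ d + d ^ d = d * d ^ d)%N.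
  by rewrite -{2}(mul1n (d ^ d)%N) -mulnDl subnK.
lia.
Qed.

Lemma absz_subD1_le (a : int) d :
  (0 < d)%N -> (`|(a - d%:R + 1)%R| <= `|a| + (d - 1))%N.
Proof. by rewrite natz; lia. Qed.

Lemma absz_sub_le (a : int) k : (`|(a - k%:Z)%R| <= `|a| + k)%N.
Proof. lia. Qed.

(* The only solutions of the preperiod-2 equation prime to d would be huge,
   since d^(d(d-1)) must divide a - d + 1. *)
Lemma preperiod2_no_int d (a : int) : prime d -> (2 < d)%N -> ~~ (d %| a)%Z ->
  (d%:R ^+ (d - 1) * a ^+ 2) ^+ d
    <> (a - d%:R + 1) * (a ^+ d + (d - 1)%:R * d%:R ^+ d) ^+ d.
Proof.
move=> d_prime d3 da.
have d0 : (0 < d)%N by lia.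
have d_le : (d.+3 <= d * (d - 1))%N by nia.
move=> eq_a; set Y := a ^+ d + _ in eq_a; set b := a - d%:R + 1 in eq_a.
(* Y is congruent to a^d modulo d. *)
have dY : coprime d `|Y|.
  rewrite prime_coprime //; apply: contra da => dY.
  apply: (dvdz_prime_exp _ _ d d_prime).
  have -> : a ^+ d = Y - (d - 1)%:R * d%:R ^+ d by rewrite /Y addrK.
  by rewrite rpredB // dvdz_mull // dvdzE abszX natz absz_nat dvdn_exp.
have a0 : a != 0 by apply: contraNneq da => ->; rewrite dvdz0.
have := congr1 absz eq_a; rewrite !abszM !abszX abszM !abszX natz absz_nat => eq_n.
have db : (d ^ (d * (d - 1)) %| `|b|)%N.
  have : (d ^ (d * (d - 1)) %| `|b| * `|Y| ^ d)%N.
    by rewrite -eq_n expnMn -expnM (mulnC d) dvdn_mulr.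
  by rewrite Gauss_dvdl // coprimeXl // coprimeXr.
have L0 : (0 < (d ^ (d - 1) * `|a| ^ 2) ^ d)%N.
  by rewrite expn_gt0 muln_gt0 !expn_gt0 d0 absz_gt0 a0.
have b0 : (0 < `|b|)%N by move: L0; rewrite eq_n muln_gt0 => /andP[].
have b_ge := dvdn_leq b0 db.
apply: (preperiod2_size d `|a| `|Y| d3).
- apply: (@leq_trans (d ^ (d * (d - 1)))%N).
    by rewrite leq_pexp2l.
  by apply: leq_trans b_ge _; apply: absz_subD1_le.
(* Replacing |b| by its lower bound d^(d(d-1)) in the equation leaves |Y|^d <= (a^2)^d. *)
- rewrite -(leq_exp2r _ _ d0) -(@leq_pmul2l (d ^ (d * (d - 1)))) ?expn_gt0 ?d0 //.
  rewrite (leq_trans (n := `|b| * `|Y| ^ d)) ?leq_mul2r ?b_ge ?orbT //.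
  by rewrite -eq_n expnMn -expnM (mulnC d).
- rewrite -abszX (_ : a ^+ d = Y - (d - 1)%:R * d%:R ^+ d); last by rewrite /Y addrK.
  have -> : ((d - 1)%:R * d%:R ^+ d : int) = ((d - 1) * d ^ d)%N%:Z.
    by rewrite -natz natrM natrX.
  exact: absz_sub_le.
Qed.

Lemma red_s1_monic d : (2 < d)%N -> size (red_s d 1) = d.+1 /\ lead_coef (red_s d 1) = 1.
Proof.
move=> d3; rewrite red_sS /red_r /red_s /= expr1n mulr1.
have XD : 'X + 1 = 'X - (-1)%:P :> {poly int} by rewrite polyCN opprK.
have sX : size (('X + 1 : {poly int}) ^+ d) = d.+1 by rewrite XD size_exp_XsubC.
have lt_s : (size ((d - 1)%:R : {poly int}) < size (('X + 1 : {poly int}) ^+ d))%N.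
  by rewrite sX -polyC_natr (leq_ltn_trans (size_polyC_leq1 _)) //; lia.
rewrite size_polyDl // lead_coefDl // sX; split=> //.
by rewrite XD lead_coef_exp lead_coefXsubC expr1n.
Qed.

Lemma red_E0_monic d : (2 < d)%N -> size (red_E d 0) = d.+1 /\ lead_coef (red_E d 0) = 1.
Proof.
move=> d3; rewrite /red_E /red_r /red_s /= expr1n mulr1.
have XD : 'X + 1 = 'X - (-1)%:P :> {poly int} by rewrite polyCN opprK.
have sX : size (('X + 1 : {poly int}) ^+ d) = d.+1 by rewrite XD size_exp_XsubC.
have lt_s : (size (- ('X * d%:R + 1) : {poly int}) < size (('X + 1 : {poly int}) ^+ d))%N.
  by rewrite size_polyN sX (posdeg_XMnatD1 d _).1 //; lia.
rewrite size_polyDl // lead_coefDl // sX; split=> //.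
by rewrite XD lead_coef_exp lead_coefXsubC expr1n.
Qed.

(** The degree is (d^2 + 1) - d - 1 = N + 1. As [red_E d 0] is monic, the leading coefficient is
    that of - (X d + 1) s^d. *)
Lemma red_G1_size d : (2 < d)%N ->
  size (red_G d 1) = ((d - 1) * d ^ 1 - 1).+2 /\ lead_coef (red_G d 1) = - d%:R.
Proof.
move=> d3; have [d1 d0] : (1 < d)%N /\ (0 < d)%N by lia.
have [s0 l0] := red_E0_monic d d3; have [ss ls] := red_s1_monic d d3.
have [sdX _] := posdeg_XMnatD1 d d0.
have rP : posdeg (red_r d 1) 2.
  rewrite red_rS /red_r /red_s /= expr1n mulr1.
  apply: (posdegM _ _ 1 1); last exact: posdeg_XD1.
  by apply: (posdegM _ _ 1 0); [exact: posdeg_XD1 | exact: posdeg_nat].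
have [sr _] := posdegX _ _ d rP.
have sR : size (('X * d%:R + 1) * red_s d 1 ^+ d) = (d * d).+2.
  have sP : posdeg (red_s d 1) d by rewrite /posdeg ls.
  by rewrite (posdegM _ _ _ _ (posdeg_XMnatD1 d d0) (posdegX _ _ d sP)).1.
have lt_s : (size (red_r d 1 ^+ d) < size (- (('X * d%:R + 1) * red_s d 1 ^+ d)))%N.
  by rewrite size_polyN sR sr; nia.
have ldX : lead_coef ('X * d%:R + 1 : {poly int}) = d%:R.
  by rewrite lead_coefE sdX /= -polyC_natr coefD coefMC coefX coef1 /= mul1r addr0.
have s1 : size (red_E d 1) = (d * d).+2 by rewrite /red_E addrC size_polyDl // size_polyN.
have l1 : lead_coef (red_E d 1) = - d%:R.
  by rewrite /red_E lead_coefDr // lead_coefN lead_coefM lead_coef_exp ls expr1n mulr1 ldX.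
have nE0 := red_E_neq0 d 0 d1.
have nE1 := red_E_neq0 d 1 d1.
have E1 := red_E_next d 0 d1.
have g0 : red_G d 1 != 0.
  by apply: contraNneq nE1 => g0; rewrite E1 g0 !mulr0.
split; last first.
  by move: l1; rewrite E1 !lead_coefM l0 lead_coefX !mul1r.
have := pdeg_red_E_next d 0 d1 nE0 g0; rewrite /pdeg s0 s1 /= expn1.
move: g0; rewrite -size_poly_gt0; case: (size _) => //= k _ kE.
have : ((d - 1) * d + d = d * d)%N by rewrite -mulSnr subn1 prednK.
by move: kE; nia.
Qed.

Lemma absz_eqN (z : int) k : `|z|%N = k -> z = k%:Z \/ z = - k%:Z.
Proof. lia. Qed.

(** The leading coefficients multiply to - d and that of A is prime to d, so that of B is e d with e
    = 1 or e = -1. The root of B is b = a / d - 1 for the integer a = d - e B_0, prime to d, and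
    E_2(b) = 0 becomes the equation of [preperiod2_no_int]. *)
Lemma red_G1_no_linear_factor d (A B : {poly int}) : prime d -> (2 < d)%N ->
  red_G d 1 = A * B -> ~~ (d %| A`_((d - 1) * d ^ 1 - 1))%Z -> ~~ (d %| B`_0)%Z ->
  size B <> 2.
Proof.
move=> d_prime d3 gE AN B0 sB; have [d1 d0] : (1 < d)%N /\ (0 < d)%N by lia.
have [sg lg] := red_G1_size d d3.
have [nA nB] : A != 0 /\ B != 0.
  by apply/andP; rewrite -negb_or -mulf_eq0 -gE -size_poly_gt0 sg.
have sA : (size A).-1 = ((d - 1) * d ^ 1 - 1)%N.
  by move: sg; rewrite gE size_mul // sB addn2 /= => -[->].
have lA : lead_coef A = A`_((d - 1) * d ^ 1 - 1) by rewrite lead_coefE sA.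
have lB : lead_coef B = B`_1 by rewrite lead_coefE sB.
move: lg; rewrite gE lead_coefM lB => lg.
have lgn : (`|lead_coef A| * `|(B`_1)%R| = d)%N.
  by rewrite -abszM lg abszN natz absz_nat.
have dB : (d %| `|(B`_1)%R|)%N.
  have : (d %| `|lead_coef A| * `|(B`_1)%R|)%N by rewrite lgn.
  by rewrite Euclid_dvdM // lA -[(d %| _)%N]/(d %| _)%Z (negPf AN).
have Bd : `|(B`_1)%R|%N = d.
  by apply/eqP; rewrite eqn_dvd dB andbT -[X in (_ %| X)%N]lgn dvdn_mull.
have [e e2 B1] : exists2 e : int, e * e = 1 & B`_1 = e * d%:R.
  have [B1|B1] : B`_1 = d%:Z \/ B`_1 = - d%:Z by apply: absz_eqN.
    by exists 1; rewrite ?mul1r // natz.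
  by exists (-1); rewrite ?mulrNN ?mul1r // mulN1r natz.
have [a aE da] : exists2 a : int, a = d%:R - e * B`_0 & ~~ (d %| a)%Z.
  exists (d%:R - e * B`_0) => //; apply: contra B0; set a := _ - _ => da.
  have -> : B`_0 = e * (d%:R - a).
    by rewrite /a; transitivity (e * e * B`_0); [rewrite e2 mul1r | ring].
  by rewrite dvdz_mull // rpredB // natz dvdzz.
pose D : rat := d%:R; pose q : rat := a%:~R; pose x : rat := q / D - 1.
have D0 : D != 0 by rewrite pnatr_eq0 -lt0n.
have Bx : (map_poly intr B).[x] = 0.
  rewrite horner_coef size_rat_int_poly sB !big_ord_recl big_ord0 !coef_map /= addr0.
  rewrite expr0 expr1 mulr1 B1 /x /q aE rmorphM rmorphB rmorphM !rmorph_nat /= -/D.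
  have e2' : (e%:~R * e%:~R : rat) = 1 by rewrite -rmorphM e2.
  transitivity ((1 - e%:~R * e%:~R) * (B`_0)%:~R : rat); first by field.
  by rewrite e2' subrr mul0r.
have Ex : (map_poly intr (red_E d 1)).[x] = 0.
  by rewrite red_E_next // gE !rmorphM !hornerM /= Bx !mulr0.
have {}Ex : (q / D * D * (q / D)) ^+ d =
    (q - D + 1) * ((q / D) ^+ d + (d - 1)%:R) ^+ d.
  move: Ex; rewrite /red_E rmorphB !rmorphM !rmorphXn red_rS red_sS.
  rewrite /red_r /red_s /= expr1n !mulr1.
rewrite !rmorphD !rmorphM !rmorphXn !rmorphD !rmorph_nat rmorph1 /= map_polyX.
rewrite -!polyC_natr !(hornerE, horner_exp) expr1n mulr1 -/D.
have -> : x + 1 = q / D by rewrite /x subrK.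
have -> : x * D + 1 = q - D + 1 by rewrite /x; field.
  by move/eqP; rewrite subr_eq0 !mulrA => /eqP.
apply: (preperiod2_no_int d a d_prime d3 da).
apply: (@intr_inj rat); rewrite rmorphXn rmorphM !rmorphXn rmorph_nat /= -/D -/q.
rewrite rmorphM rmorphD rmorphB rmorphXn rmorphD rmorphM !rmorphXn !rmorph_nat rmorph1 /=.
rewrite -/D -/q.
(* Multiplying [Ex] by (D^d)^d clears the denominators. *)
have DdE : D ^+ d = D ^+ (d - 1) * D by rewrite -exprSr subn1 prednK.
have -> : D ^+ (d - 1) * q ^+ 2 = D ^+ d * (q / D * D * (q / D)) by rewrite DdE; field.
have -> : q ^+ d + (d - 1)%:R * D ^+ d = D ^+ d * ((q / D) ^+ d + (d - 1)%:R).
  by rewrite expr_div_n; field; rewrite expf_neq0.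
by rewrite !(exprMn _ (D ^+ d)) Ex; ring.
Qed.

(** * Irreducibility for small m, and the degree bound *)

Lemma red_G_size d n : (2 < d)%N -> (n.+2 < d)%N ->
  size (red_G d n.+2) = ((d - 1) * d ^ n.+2 - 1).+1.
Proof.
move=> d3 n_lt; have d1 : (1 < d)%N by lia.
have nE1 := red_E_neq0 d n.+1 d1; have nE2 := red_E_neq0 d n.+2 d1.
have g0 : red_G d n.+2 != 0.
  by apply: contraNneq nE2 => g0; rewrite red_E_next // g0 !mulr0.
have := pdeg_red_E_next d n.+1 d1 nE1 g0.
have [_ ->] := red_E_degree d n d1; last lia.
have [_ ->] := red_E_degree d n.+1 d1; last by [].
move: g0; rewrite /pdeg -size_poly_gt0; case: (size _) => //= k _.
rewrite (expnS d n.+2); have -> : (d * d ^ n.+2 = (d - 1) * d ^ n.+2 + d ^ n.+2)%N.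
  by rewrite -mulSnr subn1 prednK //; lia.
by lia.
Qed.

Lemma red_G_irreducible d n : prime d -> (2 < d)%N -> (n < d)%N ->
  irreducible_poly (map_poly (intr : int -> rat) (red_G d n)).
Proof.
move=> d_prime d3 n_lt.
have [A [B [gE irrA AN B0]]] := red_G_irreducible_factor d n d_prime d3.
have sA : ((d - 1) * d ^ n - 1 < size A)%N.
  by rewrite ltnNge; apply: contra AN => /leq_sizeP ->; rewrite ?dvdz0.
have nA : A != 0 by rewrite -size_poly_gt0; lia.
have nB : B != 0 by apply: contraNneq B0 => ->; rewrite coef0 dvdz0.
have sg : size (red_G d n) = (size A + size B).-1 by rewrite gE size_mul.
have sB0 : (0 < size B)%N by rewrite size_poly_gt0.
suff /eqP/size_poly1P[c c0 BE] : size B = 1%N.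
  rewrite gE rmorphM BE /= map_polyC /= mulrC mul_polyC.
  have : (c%:~R *: map_poly intr A) %= map_poly (intr : int -> rat) A.
    by apply: eqp_scale; rewrite intr_eq0.
  rewrite eqp_sym => AcA; split; first by rewrite -(eqp_size AcA); case: irrA.
  by move=> q sq; rewrite -(eqp_dvdr _ AcA) => /(irrA.2 _ sq) /eqp_trans; apply.
(* For m = 1 and m >= 3 the degree is at most N, so B is constant; for m = 2 it is N + 1 and B could
   still be linear. *)
case: n n_lt gE AN sA sg => [|[|n]] n_lt gE AN sA sg.
- have : (size (red_G d 0) <= d - 1)%N.
    rewrite /= (leq_trans (size_sum _ _ _)) //; apply/bigmax_leqP => i _.
    rewrite -polyC_natr mul_polyC (leq_trans (size_scale_leq _ _)) //.
    by rewrite size_polyXn ltn_ord.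
  by move: sA; rewrite expn0 muln1; lia.
- have := red_G1_no_linear_factor d A B d_prime d3 gE AN B0.
  by have [sg1 _] := red_G1_size d d3; lia.
- by have := red_G_size d n d3 n_lt; lia.
Qed.

Lemma irreducible_comp_poly (F : fieldType) (p l l' : {poly F}) :
  size l = 2 -> size l' = 2 -> l \Po l' = 'X -> l' \Po l = 'X ->
  irreducible_poly p -> irreducible_poly (p \Po l).
Proof.
move=> sl sl' ll' l'l [sp irrp]; split; first by rewrite size_comp_poly2.
move=> q sq ql; have : q \Po l' %| p.
  by have := dvdp_comp_poly l' ql; rewrite -comp_polyA ll' comp_polyXr.
have sq' : size (q \Po l') != 1%N by rewrite size_comp_poly2.
move=> /(irrp _ sq') /andP[h1 h2]; apply/andP; split=> //.
by have := dvdp_comp_poly l h2; rewrite -comp_polyA l'l comp_polyXr.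
Qed.

(** By [red_E_degree] the degree is at most the difference of the degrees of consecutive [red_s],
    known in closed form; the last term bounds d^x. *)
Lemma red_G_degree_bound d n : (1 < d)%N ->
  ((d ^ d - 1) * pdeg (red_G d n.+2) + d ^ (d + n.+2) <= d ^ (d + n.+3) + d ^ d)%N.
Proof.
move=> d1; have nE1 := red_E_neq0 d n.+1 d1; have nE2 := red_E_neq0 d n.+2 d1.
have g0 : red_G d n.+2 != 0.
  by apply: contraNneq nE2 => g0; rewrite red_E_next // g0 !mulr0.
have := pdeg_red_E_next d n.+1 d1 nE1 g0.
have [/andP[E1 _] _] := red_E_degree d n d1.
have [/andP[_ E2] _] := red_E_degree d n.+1 d1.
move=> gE; have {gE E1 E2} :
    (pdeg (red_G d n.+2) + pdeg (red_s d n.+2) <= pdeg (red_s d n.+3))%N.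
  by lia.
have [x [_ [b [[x_le _] bE _ _ [sb _]]]]] := red_rs_degree d n.+1 d1.
have [x' [_ [b' [_ bE' _ _ [sb' _]]]]] := red_rs_degree d n.+2 d1.
rewrite -{}bE -{}bE' {2 3}/pdeg sb sb' /= => le_b.
have : (d ^ x <= d ^ d)%N by rewrite leq_pexp2l //; lia.
have : ((d ^ d - 1) * (pdeg (red_G d n.+2) + b) <= (d ^ d - 1) * b')%N.
  by rewrite leq_mul2l le_b orbT.
rewrite mulnDr; move: (d ^ d - 1)%N (d ^ d)%N (d ^ x)%N => c D y le1 le2.
by rewrite addnA; apply: leq_add (leq_trans le1 (leq_addr _ _)) le2.
Qed.

(** * The polynomials G_m *)

Lemma affine_sub_size d : (0 < d)%N ->
  let l : {poly rat} := d%:R^-1 *: 'X - 1 in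
  let l' : {poly rat} := d%:R *: 'X + d%:R%:P in
  [/\ size l = 2, size l' = 2, l \Po l' = 'X & l' \Po l = 'X].
Proof.
move=> d0 l l'; have D0 : (d%:R : rat) != 0 by rewrite pnatr_eq0 -lt0n.
have size2 (a b : rat) : a != 0 -> size (a *: 'X + b%:P) = 2.
  move=> a0; rewrite size_polyDl size_scale ?size_polyX //.
  by rewrite (leq_ltn_trans (size_polyC_leq1 _)).
split.
- by rewrite /l -polyC1 -polyCN size2 // invr_eq0.
- exact: size2.
- rewrite /l /l' comp_polyB comp_polyZ comp_polyX -polyC1 comp_polyC.
  by rewrite scalerDr scalerA mulVf // scale1r -mul_polyC -polyCM mulVf // addrK.
- rewrite /l /l' comp_polyD comp_polyZ comp_polyX comp_polyC scalerBr scalerA.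
  by rewrite divff // scale1r -mul_polyC mulr1 subrK.
Qed.

Lemma pdeg_Gpoly d n : (1 < d)%N -> pdeg (Gpoly d n.+1) = pdeg (red_G d n).
Proof.
move=> d1; have [sl _ _ _] := affine_sub_size d (ltnW d1).
have [c c0 cE] := calG_red_G d n d1.
by rewrite /pdeg /Gpoly size_comp_poly2 // cE size_scale // size_rat_int_poly.
Qed.

Lemma Gpoly_neq0 d n : prime d -> (2 < d)%N -> Gpoly d n.+1 != 0.
Proof.
move=> d_prime d3; have d1 : (1 < d)%N by lia.
have [sl _ _ _] := affine_sub_size d (ltnW d1).
have [c c0 cE] := calG_red_G d n d1; have [g0 _] := red_G_coef0 d n d_prime d3.
rewrite /Gpoly comp_poly2_eq0 // cE scaler_eq0 negb_or c0 /=.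
rewrite -size_poly_gt0 size_rat_int_poly size_poly_gt0.
by apply: contraNneq g0 => ->; rewrite coef0.
Qed.

Lemma Gpoly_irreducible d n : prime d -> (2 < d)%N -> (n < d)%N ->
  irreducible_poly (Gpoly d n.+1).
Proof.
move=> d_prime d3 n_lt; have d1 : (1 < d)%N by lia.
have [sl sl' ll' l'l] := affine_sub_size d (ltnW d1).
have [c c0 cE] := calG_red_G d n d1; apply: irreducible_comp_poly sl sl' ll' l'l _.
have [sg irrg] := red_G_irreducible d n d_prime d3 n_lt; rewrite cE.
split; first by rewrite size_scale.
move=> q sq; rewrite dvdpZr // => /(irrg _ sq) /eqp_trans; apply.
by rewrite eqp_sym eqp_scale.
Qed.

Lemma Gpoly_large_factor d n : prime d -> (2 < d)%N ->
  exists F : {poly rat}, [/\ irreducible_poly F, F %| Gpoly d n.+1 &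
    ((d - 1) * d ^ n - 1 <= pdeg F)%N].
Proof.
move=> d_prime d3; have d1 : (1 < d)%N by lia.
have [sl sl' ll' l'l] := affine_sub_size d (ltnW d1).
have [c c0 cE] := calG_red_G d n d1.
have [A [B [gE irrA AN _]]] := red_G_irreducible_factor d n d_prime d3.
exists (map_poly intr A \Po (d%:R^-1 *: 'X - 1)); split.
- exact: irreducible_comp_poly sl sl' ll' l'l irrA.
- by apply: dvdp_comp_poly; rewrite cE dvdpZr // gE rmorphM dvdp_mulr.
rewrite /pdeg size_comp_poly2 // size_rat_int_poly.
suff : ((d - 1) * d ^ n - 1 < size A)%N by case: (size A).
by rewrite ltnNge; apply: contra AN => /leq_sizeP ->; rewrite ?dvdz0.
Qed.

(** * The lower limit of the degree ratio *)

(** f / g >= N / g >= (1 - 1/D) N / (N + 2), and N / (N + 2) = 1 - 2 / (N + 2). *)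
Lemma ratio_lower_bound (R : realFieldType) (N f g n D : R) :
  1 < D -> (D - 1) * g <= D * (N + 2) -> N <= f -> 0 < g -> n <= N + 2 ->
  0 < N -> 0 < n -> 1 - 1 / D - 2 * n^-1 <= f / g.
Proof.
move=> D1 gN f_ge g0 N_ge N0 n0.
apply: (@le_trans _ _ (N / g)); last by rewrite ler_pM2r ?invr_gt0.
have D0 : 0 < D by lra.
have N2 : 0 < N + 2 by lra.
apply: (@le_trans _ _ ((1 - 1 / D) * (N / (N + 2)))).
  have inv_le : (N + 2)^-1 <= n^-1 by rewrite lef_pV2.
  have -> : (1 - 1 / D) * (N / (N + 2)) =
      1 - 1 / D - 2 * (N + 2)^-1 + 1 / D * (2 * (N + 2)^-1).
    by field; rewrite ?gt_eqF.
  have : 0 <= 1 / D * (2 * (N + 2)^-1).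
    by rewrite !mulr_ge0 ?invr_ge0 // ltW.
  by lra.
rewrite ler_pdivlMr // -subr_ge0.
have -> : N - (1 - 1 / D) * (N / (N + 2)) * g =
    N / (D * (N + 2)) * (D * (N + 2) - (D - 1) * g).
  by field; rewrite ?gt_eqF.
by rewrite mulr_ge0 ?subr_ge0 // divr_ge0 ?ltW // mulr_gt0.
Qed.

Lemma factor_ratio_bound d n (R : realFieldType) (f : nat) :
  prime d -> (2 < d)%N ->
  ((d - 1) * d ^ n.+2 - 1 <= f)%N -> (f <= pdeg (Gpoly d n.+3))%N ->
  1 - 1 / d%:R ^+ d - 2 * (n.+4%:R)^-1 <= f%:R / (pdeg (Gpoly d n.+3))%:R :> R.
Proof.
move=> d_prime d3 f_ge f_le; have d1 : (1 < d)%N by lia.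
have := red_G_degree_bound d n d1; rewrite -pdeg_Gpoly // => g_le.
move: (pdeg _) f_le g_le => g f_le g_le.
have dn : (n.+2 < d ^ n.+2)%N by apply: ltn_expl.
set N := ((d - 1) * d ^ n.+2 - 1)%N in f_ge.
have NE : (N + 1 = (d - 1) * d ^ n.+2)%N by rewrite /N subnK // muln_gt0; lia.
(* A crude linear bound on N suffices for the error term to tend to 0. *)
have N_ge : (n.+4 <= N + 2)%N.
  have : (2 * d ^ n.+2 <= (d - 1) * d ^ n.+2)%N by rewrite leq_mul2r; lia.
  by lia.
have gN : ((d ^ d - 1) * g <= d ^ d * (N + 2))%N.
  have : (d ^ (d + n.+3) = d ^ d * (N + 1) + d ^ (d + n.+2))%N.
    rewrite NE [(d + n.+3)%N]addnS expnS !expnD.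
    have -> : (d * (d ^ d * d ^ n.+2) = (d - 1 + 1) * (d ^ d * d ^ n.+2))%N.
      by rewrite subnK // ltnW.
    by ring.
  by move: g_le; rewrite (addnS N) mulnS; lia.
have dd1 : (1 < d ^ d)%N by rewrite -{1}(expn0 d) ltn_exp2l //; lia.
have N0 : (0 < N)%N by lia.
have g0 : (0 < g)%N by lia.
clear g_le dn NE d_prime; move: N f_ge N_ge gN N0 => N f_ge N_ge gN N0.
pose D : R := d%:R ^+ d.
have DE : D = (d ^ d)%:R by rewrite natrX.
have D1 : 1 < D by rewrite DE ltr1n.
have {}gN : (D - 1) * g%:R <= D * (N%:R + 2).
  have := gN; rewrite -(@ler_nat R) !natrM natrB; last exact: ltnW.
  by rewrite -DE natrD.
have {}f_ge : (N%:R : R) <= f%:R by rewrite ler_nat.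
have {}g0 : 0 < (g%:R : R) by rewrite ltr0n.
have {}N_ge : (n.+4%:R : R) <= N%:R + 2 by rewrite -natrD ler_nat.
have {}N0 : 0 < (N%:R : R) by rewrite ltr0n.
have n0 : 0 < (n.+4%:R : R) by rewrite ltr0n.
exact: (ratio_lower_bound _ N%:R _ _ _ D).
Qed.

(** The error e / (n + 1) decreases, so the bound at n also bounds the infimum of the tail, and
    these bounds tend to c. *)
Lemma limn_einf_ge (R : realType) (u : nat -> R) (c e : R) k : 0 <= e ->
  (forall n, c - e * (n + k).+1%:R^-1 <= u (n + k)%N) ->
  (c%:E <= limn_einf (fun n => (u n)%:E))%E.
Proof.
move=> e0 u_ge; rewrite limn_einf_lim.
have v_cvg : ((fun n => (c - e * n.+1%:R^-1)%:E) @ \oo --> c%:E)%classic.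
  apply: cvg_EFin; first exact: nearW.
  rewrite -[X in (_ --> X)%classic]subr0 -(mulr0 e); apply: cvgB; first exact: cvg_cst.
  by apply: cvgMr; exact: cvg_harmonic.
rewrite -(cvg_lim _ v_cvg) //; apply: lee_lim.
- by apply/cvg_ex; exists c%:E.
- exact: is_cvg_einfs.
near=> n; apply: le_ereal_inf_tmp => _ [m /= nm <-]; rewrite lee_fin.
have km : (k <= m)%N by apply: leq_trans nm; near: n; exact: nbhs_infty_ge.
have := u_ge (m - k)%N; rewrite subnK //; apply: le_trans.
by rewrite lerD2l lerN2 ler_wpM2l // lef_pV2 ?posrE ?ltr0n // ler_nat.
Unshelve. all: by end_near. Qed.

Theorem mainTheorem1 (d : nat) (d_prime : prime d) (d_ge3 : (3 <= d)%N) :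
  (exists F : nat -> {poly rat},
     (forall m : nat, (1 <= m)%N ->
        irreducible_poly (F m) /\ F m %| Gpoly d m)
     /\
     (forall R : realType,
        ((1 - 1 / d%:R ^+ d : R)%:E <=
         limn_einf (fun m : nat =>
           ((pdeg (F m))%:R / (pdeg (Gpoly d m))%:R : R)%:E))%E))
  /\
  (forall m : nat, (1 <= m <= d)%N -> irreducible_poly (Gpoly d m)).
Proof.
split; last by case=> // m m_le; apply: Gpoly_irreducible.
have [F FP] := choice (fun n => Gpoly_large_factor d n d_prime d_ge3).
exists (fun m => F m.-1); split=> [[|m] // _|R]; first by case: (FP m).
(* The constants match [factor_ratio_bound]: its error at m = n + 3 is 2 / (n + 4). *)
apply: (@limn_einf_ge _ _ _ 2 3) => // n; rewrite addn3 /=.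
have [irrF F_dvd F_ge] := FP n.+2.
apply: factor_ratio_bound => //.
have G0 := Gpoly_neq0 d n.+2 d_prime d_ge3.
by rewrite /pdeg -!subn1 leq_sub2r // dvdp_leq.
Qed.
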